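(* Let $\alpha>\beta+1/2>0$, put $\alpha':=2\beta+1-\alpha$, and let $$\mathcal{F}:=\left\{f:[0,1]\to\mathbb{R}\ \middle|\ f(x)=x^{\beta}\int_1^\infty t^{\alpha'}e^{-tx}\,\mu(\mathrm{d}t),\ \|\mu\|_{TV}\le1\right\},$$ where $\mu$ ranges over the finite signed Borel measures on $[1,\infty)$ with total variation norm at most $1$. Then, as $\varepsilon\to0^+$, $$\log N(\varepsilon,\mathcal{F},\|\cdot\|_2)\asymp|\log\varepsilon|^3.$$
   Context: Here $\|f\|_2=\left(\int_0^1 f(x)^2\,\mathrm{d}x\right)^{1/2}$ is the $L_2[0,1]$ norm, functions in $\mathcal{F}$ are regarded as elements of $L_2[0,1]$ (so the value at $x=0$ is irrelevant), and $N(\varepsilon,\mathcal{F},\|\cdot\|_2)$ is the minimum number of balls of radius $\varepsilon$ in the norm $\|\cdot\|_2$ needed to cover $\mathcal{F}$. The notation $f\asymp g$ means that $\limsup f/g<\infty$ and $\limsup g/f<\infty$ (here as $\varepsilon\to0^+$). *)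

(* Defs.v *)
From HB Require Import structures.
From mathcomp Require Import all_boot all_order all_algebra.
From mathcomp Require Import all_classical all_reals all_analysis.

Set Implicit Arguments.
Unset Strict Implicit.
Unset Printing Implicit Defensive.

Import Order.TTheory GRing.Theory Num.Theory.
Import numFieldNormedType.Exports.

Local Open Scope classical_set_scope.
Local Open Scope ring_scope.

Section SignedMeasures.
Context d (T : measurableType d) (R : realType).
Variable nu : {charge set T -> \bar R}.

(* Hahn decompositions are unique up to null sets, so the choice made here
   affects neither the variation nor the integral below. *)
Definition hahn_pos : set T := projT1 (cid (Hahn_decomposition nu)).

Definition hahn_neg : set T := projT1 (cid (projT2 (cid (Hahn_decomposition nu)))).

Definition hahn_posneg : hahn_decomposition nu hahn_pos hahn_neg :=
  projT2 (cid (projT2 (cid (Hahn_decomposition nu)))).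

Definition charge_tv_norm : \bar R := charge_variation hahn_posneg setT.

Definition charge_integral (D : set T) (h : T -> R) : R :=
  \int[jordan_pos hahn_posneg]_(t in D) h t
  - \int[jordan_neg hahn_posneg]_(t in D) h t.

End SignedMeasures.

Section EntropyL2.
Context {R : realType}.
Implicit Types (f g : R -> R) (F : set (R -> R)) (e : R).

Local Notation leb := (@lebesgue_measure R).

(* A function on [0, 1] is represented by any f : R -> R extending it; it is
   replaced by its extension by zero before measurability and norm are
   considered, so the values of f outside [0, 1] are irrelevant. *)
Definition L2_01 : set (R -> R) :=
  [set g | (g \_ `[0%R, 1%R] : R -> R) \in Lfun leb 2%:E].

Definition L2norm01 f : \bar R :=
  'N[leb]_2%:E [EFin \o (f \_ `[0%R, 1%R] : R -> R)].

Definition L2_covers F e (n : nat) : Prop :=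
  exists c : 'I_n -> (R -> R),
    (forall i, L2_01 (c i)) /\
    (forall f, F f -> exists i, (L2norm01 (fun x => f x - c i x)%R < e%:E)%E).

(* +oo when no finite cover exists. *)
Definition covering_number F e : \bar R :=
  ereal_inf [set (n%:R)%:E | n in [set n | L2_covers F e n]].

(* Quotients are in the extended reals, where x / 0 = +oo for x > 0 and
   x / +oo = 0. *)
Definition asymp_at0 (f g : R -> \bar R) : Prop :=
  (limf_esup (fun e => f e / g e) 0^'+ < +oo)%E /\
  (limf_esup (fun e => g e / f e) 0^'+ < +oo)%E.

End EntropyL2.

Section LaplaceClass.
Context {R : realType}.

(* Signed measures on [1, +oo[ are the charges on the Borel sets of R that
   vanish on every Borel subset of the complement of [1, +oo[. The value of f
   at 0 is left free: only the class of f in L_2[0, 1] matters. *)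
Definition laplace_class (alpha beta : R) : set (R -> R) :=
  [set f | exists mu : {charge set (measurableTypeR R) -> \bar R},
    [/\ mu.-null_set (~` `[1%R, +oo[),
        (charge_tv_norm mu <= 1%:E)%E &
        forall x : R, x \in `]0, 1] ->
          f x = x `^ beta *
            charge_integral mu `[1%R, +oo[
              (fun t => t `^ (2 * beta + 1 - alpha) * expR (- (t * x)))]].

End LaplaceClass.

(* Main.v *)
Require Import Defs.
From HB Require Import structures.
From mathcomp Require Import all_boot all_order all_algebra.
From mathcomp Require Import all_classical all_reals all_analysis.
From mathcomp Require Import measurable_realfun ring lra zify.
Import Order.TTheory GRing.Theory Num.Theory.
Import numFieldNormedType.Exports.
Local Open Scope classical_set_scope.
Local Open Scope ring_scope.

(* Write a = 2 beta + 1 - alpha and L = |ln e|.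

   Lower bound. The functions x^beta t_j^a e^{-t_j x} with t_j = e^{N + j/N},
   j < N^2, N of order L, are nearly independent: on [0, +oo[ the distance of
   e^{-t_i x} to the span of its predecessors is
   (2 t_i)^{-1/2} prod_{j < i} (t_i - t_j) / (t_i + t_j) >= e^{-O(N)}, and
   since all t_j >= e^N, passing to [e^{-2N}, 1], where the weight x^beta is
   at least e^{-O(N)}, loses only a factor e^{-O(N)}. Hence the
   (2^N)^(N^2) combinations with coefficients k_j / 8^N, k_j < 2^N, all lie in
   the class and are e^{-O(N)}-separated.

   Upper bound. Choose p with max(0, a) < p < beta + 1/2, so that x^(beta - p)
   is in L2. Cut [1, +oo[ at the knots (5/4)^k; on the k-th cell expand
   e^{-(t - t_k) x} to order N in powers of (t - t_k) x, and drop the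
   contribution of t >= (5/4)^N. Uniformly in t this costs
   e^{-cN} x^(beta - p), so every f in the class is, up to that error, a
   combination of N^2 fixed functions with bounded coefficients, which are then
   rounded to a grid of step 2^{-N}: (2^N + 1)^(2 N^2) centres suffice. *)

Set Implicit Arguments.
Unset Strict Implicit.
Unset Printing Implicit Defensive.

(** * Cauchy quadratic forms *)

Section Cauchy.
Context {R : realType}.
Implicit Types (t v : nat -> R) (n : nat).

(** For positive nodes this is the Gram form of the exponentials: the squared L2 norm over [0, +oo[
    of sum_j v_j e^{-t_j x}. *)
Definition cauchy_form n t v : R :=
  \sum_(j < n) \sum_(k < n) v j * v k / (t j + t k).

(* Induction by Schur complements: with s = t 0,
   1 / (x + y) - 2 s / ((x + s) (y + s)) =
     ((x - s) / (x + s)) ((y - s) / (y + s)) / (x + y). *)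
Lemma cauchy_form_ge n t v : (forall j, 0 < t j) ->
  v n ^+ 2 * \prod_(j < n) ((t n - t j) / (t n + t j)) ^+ 2 / (2 * t n)
    <= cauchy_form n.+1 t v.
Proof.
elim: n t v => [|n IHn] t v t0.
  by rewrite /cauchy_form !big_ord1 big_ord0 mulr1 mulr_natl.
have t0S j : 0 < t j.+1 by [].
(* [v'] vanishes at index 0, so its form is one of order n + 1 on the shifted nodes; by the identity
   above, the forms of [v] and [v'] differ by 2 s times a perfect square. *)
pose v' j := v j * (t j - t 0%N) / (t j + t 0%N).
have st j : t j + t 0%N != 0 by rewrite gt_eqF// addr_gt0.
have tt j k : t j + t k != 0 by rewrite gt_eqF// addr_gt0.
apply: (@le_trans _ _ (cauchy_form n.+2 t v')).
  have -> : cauchy_form n.+2 t v' = cauchy_form n.+1 (t \o S) (v' \o S).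
    have v'0 : v' 0%N = 0 by rewrite /v' subrr mulr0 mul0r.
    rewrite /cauchy_form big_ord_recl/= big1 ?add0r => [|k _].
      by apply: eq_bigr => j _; rewrite big_ord_recl/= v'0 mulr0 mul0r add0r.
    by rewrite v'0 !mul0r.
  apply: le_trans (IHn _ _ t0S) => /=.
  rewrite big_ord_recl /= /v' !exprMn !exprVn.
  rewrite le_eqVlt; apply/orP; left; apply/eqP.
  by rewrite !mulrA; congr (_ * _ / _); rewrite -!mulrA; congr (_ * _); rewrite !mulrA.
rewrite -subr_ge0.
have -> : cauchy_form n.+2 t v - cauchy_form n.+2 t v' =
    2 * t 0%N * (\sum_(j < n.+2) v j / (t j + t 0%N)) ^+ 2.
  rewrite expr2 big_distrlr/= mulr_sumr -sumrB; apply: eq_bigr => j _.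
  rewrite mulr_sumr -sumrB; apply: eq_bigr => k _; rewrite /v'.
  by field; rewrite !st !tt.
by rewrite mulr_ge0 ?sqr_ge0// mulr_ge0// ltW.
Qed.

(** Each 1 / (t_j + t_k) is at most 1. This crude bound serves for the part of the norm beyond x =
    1, where the coefficients are already tiny. *)
Lemma cauchy_form_le n t v : (forall j, 1 <= t j) ->
  cauchy_form n t v <= (\sum_(j < n) `|v j|) ^+ 2.
Proof.
move=> t1; rewrite expr2 big_distrlr/=; apply: ler_sum => j _; apply: ler_sum => k _.
rewrite -normrM; apply: le_trans (ler_norm _) _; rewrite [leLHS]normrM ler_piMr// normfV.
have tjk : 1 <= t j + t k by rewrite -[1]addr0 lerD// (le_trans ler01).
by rewrite invf_le1 ger0_norm ?(le_trans _ tjk)// (lt_le_trans ltr01).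
Qed.

(** A single term of the exponential series at n: n^n / n! <= e^n. *)
Lemma fact_ge_expR n : expR (- n%:R) * n%:R ^+ n <= n`!%:R :> R.
Proof.
rewrite expRN mulrC ler_pdivrMr ?expR_gt0//.
case: n => [|n]; first by rewrite expr0 expR0 fact0 mulr1.
rewrite mulrC -ler_pdivrMr ?ltr0n ?fact_gt0//.
by apply: le_trans (expR_ge1Dxn n (ler0n _ _)); rewrite lerDr.
Qed.

(** For z <= 1/2, (1 + z) / (1 - z) <= 1 + 4 z <= e^{4 z}; then invert. *)
Lemma blaschke_ge_expR (z : R) : 0 <= z -> z <= 1 / 2 ->
  expR (- (4 * z)) <= (1 - z) / (1 + z).
Proof.
move=> z0 z1; rewrite expRN -[leRHS]invrK lef_pV2 ?posrE ?expR_gt0//; last first.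
  by rewrite invr_gt0 divr_gt0//; lra.
apply: le_trans (expR_ge1Dx _); rewrite invf_div ler_pdivrMr; last lra.
nra.
Qed.

(* The factors with l < N are at least (l + 1) / (4 N), for a total of at least
   N! / (4 N)^N >= e^{-3 N}; those with l >= N are at least 1 - O(e^{-l/N}),
   for a total of at least e^{-4 N}, uniformly in n. *)
Lemma blaschke_prod_ge (N n : nat) : (0 < N)%N ->
  expR (- (7 * N%:R)) <=
  \prod_(l < n) ((1 - expR (- (l.+1%:R / N%:R))) / (1 + expR (- (l.+1%:R / N%:R)))) :> R.
Proof.
move=> N0; set F := (fun l : nat => (1 - expR (- (l.+1%:R / N%:R))) / (1 + expR (- (l.+1%:R / N%:R))) : R).
rewrite -[leRHS]/(\prod_(l < n) F l).
have NR : (0 : R) < N%:R by rewrite ltr0n.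
have e1 l : expR (- (l.+1%:R / N%:R)) < 1 :> R by rewrite expR_lt1 oppr_lt0 divr_gt0 ?ltr0n.
have F0 l : 0 <= F l.
  apply: divr_ge0; last by rewrite addr_ge0 ?expR_ge0.
  by rewrite subr_ge0 ltW.
have F1 l : F l <= 1.
  rewrite ler_pdivrMr ?mul1r; last by rewrite addr_gt0// expR_gt0.
  by rewrite lerD// (le_trans (y := 0)) ?oppr_le0 ?expR_ge0.
(* All factors lie in [0, 1], so extending the product to N + n factors only decreases it, and it
   can be cut at N whatever n is. *)
apply: (@le_trans _ _ (\prod_(l < N + n) F l)); last first.
  rewrite addnC big_split_ord/= ler_piMr ?prodr_ge0//.
  by rewrite prodr_ile1// => i _; rewrite F0 F1.
rewrite big_split_ord/=.
have -> : - (7 * N%:R) = - (3 * N%:R) - 4 * N%:R :> R by ring.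
rewrite expRD ler_pM ?expR_ge0//.
  apply: (@le_trans _ _ (\prod_(l < N) (l.+1%:R / (4 * N%:R)))).
    have -> : \prod_(l < N) (l.+1%:R / (4 * N%:R)) = N`!%:R / (4 * N%:R) ^+ N :> R.
      by rewrite big_split/= prodr_const card_ord exprVn fact_prod natr_prod big_add1 big_mkord.
    rewrite ler_pdivlMr ?exprn_gt0 ?mulr_gt0//.
    apply: le_trans (fact_ge_expR N); rewrite exprMn mulrA ler_wpM2r ?exprn_ge0 ?ler0n//.
    (* One e^{-N} pays for N! >= (N/e)^N; the other two absorb 4^N, since 4 <= e^2. *)
    have -> : - (3 * N%:R) = - N%:R + N%:R * -2 :> R by ring.
    rewrite expRD expRM_natl -mulrA -exprMn.
    rewrite ler_piMr ?expR_ge0//.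
    rewrite exprn_ile1// ?mulr_ge0 ?expR_ge0//.
    rewrite expRN -ler_pdivlMr ?mul1r// invf_ple ?posrE ?expR_gt0 ?ltr0n// invrK.
    have -> : (2 : R) = 1 + 1 by ring.
    rewrite expRD (le_trans (y := 2 * 2))//; first lra.
    have := expR_ge1Dx (1 : R) => ?.
    by rewrite ler_pM//; lra.
  (* With u = (l + 1) / N <= 1, e^{-u} <= 1 / (1 + u) gives 1 - e^{-u} >= u / 2, while the
     denominator is at most 2. *)
  apply: ler_prod => l _; rewrite divr_ge0 ?mulr_ge0//=.
  rewrite /F; set u : R := l.+1%:R / N%:R; have u0 : 0 <= u by rewrite divr_ge0.
  have u1 : u <= 1 by rewrite ler_pdivrMr// mul1r ler_nat.
  have -> : l.+1%:R / (4 * N%:R) = u / 4 by rewrite /u; field; rewrite gt_eqF.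
  rewrite ler_pdivlMr; last by rewrite addr_gt0// expR_gt0.
  have /= := expR_ge1Dx u => eu.
  have eu0 : 0 < expR (- u) by exact: expR_gt0.
  have : expR (- u) * (1 + u) <= 1.
    by rewrite expRN mulrC ler_pdivrMr ?expR_gt0// mul1r.
  move=> h.
  nra.
apply: (@le_trans _ _ (\prod_(l < n) expR (- (4 * expR (- ((N + l).+1%:R / N%:R)))))); last first.
  apply: ler_prod => l _; rewrite expR_ge0/=; apply: blaschke_ge_expR; rewrite ?expR_ge0//.
  rewrite expRN mul1r lef_pV2 ?posrE ?expR_gt0// (le_trans _ (expR_ge1Dx _))//.
  have : 1 <= (N + l).+1%:R / N%:R :> R by rewrite ler_pdivlMr// mul1r ler_nat ltnW// ltnS leq_addr.
  lra.
rewrite -expR_sum ler_expR sumrN lerN2 -mulr_sumr ler_wpM2l//.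
(* The exponents are dominated by a geometric series of ratio [r], and r (1 + 1/N) <= 1 says exactly
   that its sum r / (1 - r) is at most N. *)
pose r : R := expR (- N%:R^-1).
have r0 : 0 < r by exact: expR_gt0.
have rN : r * (1 + N%:R^-1) <= 1.
  by rewrite /r expRN mulrC ler_pdivrMr ?expR_gt0// mul1r expR_ge1Dx.
have r1 : r < 1 by rewrite /r expR_lt1 oppr_lt0 invr_gt0.
apply: (@le_trans _ _ (\sum_(l < n) r ^+ l.+1)).
  apply: ler_sum => l _; rewrite /r -expRM_natl ler_expR -addnS natrD mulrDl divff ?gt_eqF//.
  by rewrite mulrN lerN2 lerDr.
apply: (@le_trans _ _ (r / (1 - r))); last first.
  rewrite ler_pdivrMr ?subr_gt0//.
  have NV : N%:R^-1 * N%:R = 1 :> R by rewrite mulVf ?gt_eqF.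
  have := rN; rewrite -(ler_pM2r NR) -mulrA mulrDl NV mul1r; nra.
rewrite ler_pdivlMr ?subr_gt0//; under eq_bigr do rewrite exprS.
rewrite -mulr_sumr -mulrA ler_piMr ?(ltW r0)// mulrC -opprB mulNr -subrX1 opprB.
by rewrite gerBl exprn_ge0// ltW.
Qed.
End Cauchy.

(** * Atomic measures in the class *)

Section FinitePositiveCharge.
Context d (T : measurableType d) (R : realType) (mu : {finite_measure set T -> \bar R}).

Let nu : {charge set T -> \bar R} := charge_of_finite_measure mu.

(** The Hahn sets come from a choice and are unknown, but a positive measure vanishes inside any
    negative set. *)
Lemma jordan_neg_finite_measure A : measurable A ->
  jordan_neg (hahn_posneg nu) A = 0%E.
Proof.
move=> mA; have [_ [mN nN] _ _] := hahn_posneg nu.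
rewrite jordan_negE cjordan_negE /crestr0 mem_set// /crestr.
have mAN : measurable (A `&` hahn_neg nu) by exact: measurableI.
suff -> : nu (A `&` hahn_neg nu) = 0%E by rewrite oppe0.
by apply/eqP; rewrite eq_le nN//=.
Qed.

Lemma jordan_pos_finite_measure A : measurable A ->
  jordan_pos (hahn_posneg nu) A = mu A.
Proof.
move=> mA; rewrite -[mu A]/(nu A) (jordan_decomp (hahn_posneg nu) mA) /cadd cscaleN1.
rewrite -[LHS]adde0; congr (_ + _)%E.
transitivity (- jordan_neg (hahn_posneg nu) A)%E; last by rewrite /cscale -mulN1e.
by rewrite jordan_neg_finite_measure// oppe0.
Qed.

Lemma charge_tv_norm_finite_measure : charge_tv_norm nu = mu setT.
Proof.
transitivity (jordan_pos (hahn_posneg nu) setT + jordan_neg (hahn_posneg nu) setT)%E => //.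
by rewrite jordan_pos_finite_measure// jordan_neg_finite_measure// adde0.
Qed.

Lemma charge_integral_finite_measure D (h : T -> R) : measurable D ->
  charge_integral nu D h = \int[mu]_(t in D) h t.
Proof.
move=> mD; rewrite /charge_integral /Rintegral.
rewrite (@eq_measure_integral _ _ _ _ mu) => [|A mA _]; last exact: jordan_pos_finite_measure.
rewrite [X in _ - fine X](@eq_measure_integral _ _ _ _ mzero) => [|A mA _]; last first.
  exact: jordan_neg_finite_measure.
by rewrite integral_measure_zero subr0.
Qed.

End FinitePositiveCharge.

(** * Finite sums of point masses *)

Section AtomicMeasure.
Context {R : realType}.
Variables (n : nat) (t : nat -> R) (a : nat -> {nonneg R}).

(** Nonnegative weights suffice for the lower bound: signs enter only through differences of two
    members of the class. *)
Definition atomic_measure : set (measurableTypeR R) -> \bar R :=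
  msum (fun j => mscale (a j) (dirac (t j : measurableTypeR R))) n.

HB.instance Definition _ := Measure.on atomic_measure.

Lemma atomic_measureE A :
  atomic_measure A = (\sum_(j < n) (a j)%:num%:E * (\1_A (t j))%:E)%E.
Proof. by []. Qed.

Let fin : fin_num_fun atomic_measure.
Proof.
move=> A mA; rewrite atomic_measureE sumEFin; exact: fin_numE.
Qed.

HB.instance Definition _ := Measure_isFinite.Build _ _ _ atomic_measure fin.

Lemma Rintegral_atomic_measure (D : set (measurableTypeR R)) (h : measurableTypeR R -> R) :
  measurable D -> measurable_fun D h -> (forall x, D x -> 0 <= h x) ->
  (forall j, D (t j)) ->
  \int[atomic_measure]_(x in D) h x = \sum_(j < n) (a j)%:num * h (t j).
Proof.
move=> mD mh h0 Dt; rewrite /Rintegral ge0_integral_measure_sum//; last first.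
  exact/measurable_EFinP.
rewrite (eq_bigr (fun j : 'I_n => ((a j)%:num * h (t j))%:E)); last first.
  move=> j _; rewrite ge0_integral_mscale//; last exact/measurable_EFinP.
  rewrite integral_dirac//; last exact/measurable_EFinP.
  by rewrite diracE mem_set// mul1e.
by rewrite sumEFin.
Qed.

End AtomicMeasure.

Section AtomicFunctions.
Context {R : realType}.
Variables alpha beta : R.

Lemma laplace_class_atomic n (t : nat -> R) (a : nat -> {nonneg R}) :
  (forall j, 1 <= t j) -> \sum_(j < n) (a j)%:num <= 1 ->
  laplace_class alpha beta (fun x => x `^ beta *
    \sum_(j < n) (a j)%:num * (t j `^ (2 * beta + 1 - alpha) * expR (- (t j * x)))).
Proof.
move=> t1 a1; pose mu := [the {finite_measure set (measurableTypeR R) -> \bar R} of atomic_measure n t a].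
have tI j : `[1, +oo[%classic (t j) by rewrite /= in_itv/= t1.
exists (charge_of_finite_measure mu); split.
- move=> A mA AN; rewrite -[LHS]/(atomic_measure n t a A) atomic_measureE big1// => j _.
  rewrite indicE memNset ?mule0// => Atj.
  by apply: (AN _ Atj); exact: tI.
- rewrite charge_tv_norm_finite_measure -[leLHS]/(atomic_measure n t a setT).
  rewrite atomic_measureE; under eq_bigr do rewrite indicT mule1.
  by rewrite sumEFin lee_fin.
- move=> x x01; congr (_ * _); rewrite charge_integral_finite_measure//.
  rewrite Rintegral_atomic_measure// => [|u _]; last by rewrite mulr_ge0 ?powR_ge0 ?expR_ge0.
  apply: measurable_funM; first exact: measurable_funTS.
  apply: measurable_funTS; apply: measurableT_comp => //.
  apply: measurableT_comp => //; exact: measurable_funM.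
Qed.

End AtomicFunctions.

(** * The L2 norm on [0, 1] *)

Section L2Norm.
Context {R : realType}.
Implicit Types (f g h c : R -> R).

Local Notation leb := (@lebesgue_measure R).
Local Notation I01 := `[0 : R, 1 : R]%classic.

Lemma L2norm01E h :
  L2norm01 h = sqrte (\int[leb]_(x in I01) (h x ^+ 2)%:E)%E.
Proof.
rewrite /L2norm01 Lnorm.unlock poweR12_sqrt; last first.
  by apply: integral_ge0 => x _; exact: poweR_ge0.
rewrite [in RHS]integral_mkcond; congr sqrte; apply: eq_integral => x _ /=.
rewrite !patchE; case: ifPn => _.
  by rewrite powR_mulrn// -normrX ger0_norm ?sqr_ge0.
by rewrite normr0 powR0.
Qed.

Lemma L2norm01_lt h e : 0 < e ->
  (L2norm01 h < e%:E)%E = (\int[leb]_(x in I01) (h x ^+ 2)%:E < (e ^+ 2)%:E)%E.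
Proof.
move=> e0; rewrite L2norm01E !ltNge; congr negb.
rewrite -(@lee_sqrt R (e ^+ 2)%:E); last by apply: integral_ge0 => x _; rewrite lee_fin sqr_ge0.
by rewrite /= sqrtr_sqr (ger0_norm (ltW e0)).
Qed.

Lemma measurable_funS01 f : measurable_fun I01 f ->
  measurable_fun I01 (fun x => (f x ^+ 2)%:E).
Proof. by move=> mf; apply/measurable_EFinP; exact: measurable_funX. Qed.

(** Two functions in one ball are close, by integrating (f - g)^2 <= 2 (f - c)^2 + 2 (g - c)^2;
    working with squares avoids the triangle inequality for the norm. *)
Lemma L2_separation f g c e : 0 < e ->
    measurable_fun I01 f -> measurable_fun I01 g -> L2_01 c ->
  (L2norm01 (fun x => f x - c x)%R < e%:E)%E ->
  (L2norm01 (fun x => g x - c x)%R < e%:E)%E ->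
  (\int[leb]_(x in I01) ((f x - g x) ^+ 2)%:E < (4 * e ^+ 2)%:E)%E.
Proof.
move=> e0 mf mg /andP[]; rewrite inE/= => mc _.
have {}mc : measurable_fun I01 c.
  apply: (eq_measurable_fun (c \_ I01)); last exact: measurable_funTS.
  by move=> x xI; rewrite patchE xI.
rewrite !L2norm01_lt// => fc gc.
have m2 h : measurable_fun I01 h -> measurable_fun I01 (fun x => ((h x - c x) ^+ 2)%:E).
  by move=> mh; apply: measurable_funS01; exact: measurable_funB.
have i0 h : (0 <= \int[leb]_(x in I01) ((h x - c x) ^+ 2)%:E)%E.
  by apply: integral_ge0 => x _; rewrite lee_fin sqr_ge0.
apply: (@le_lt_trans _ _ (2%:E * ((\int[leb]_(x in I01) ((f x - c x) ^+ 2)%:E) +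
   (\int[leb]_(x in I01) ((g x - c x) ^+ 2)%:E)))%E).
  rewrite -ge0_integralD//; try by [move=> x _; rewrite lee_fin sqr_ge0 | exact: m2].
  rewrite -ge0_integralZl_EFin//; last 2 first.
    by move=> x _; rewrite adde_ge0// lee_fin sqr_ge0.
    by apply: emeasurable_funD; exact: m2.
  apply: ge0_le_integral => //.
  - by move=> x _; rewrite lee_fin sqr_ge0.
  - by apply: measurable_funS01; exact: measurable_funB.
  - by apply/measurable_EFinP; apply: measurable_funM => //; apply: measurable_funD;
     apply: measurable_funX; exact: measurable_funB.
  - move=> x _; rewrite -EFinD -EFinM lee_fin.
    have := sqr_ge0 (f x - c x + (g x - c x)); nra.
have -> : (4 * e ^+ 2)%:E = (2%:E * ((e ^+ 2)%:E + (e ^+ 2)%:E))%E.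
  by rewrite -EFinD -EFinM; congr EFin; ring.
by rewrite lte_pmul2l// lteD// ge0_fin_numE// (lt_trans fc) ?ltry.
Qed.

(* The functions of the class are only known through an integral, and nothing
   is assumed about their value at 0: dropping the measurability of f1 and f2
   avoids having to prove that they are measurable. *)
Lemma ge0_le_integral_nonmeasurable (D : set R) (f1 f2 : R -> \bar R) :
  (forall x, D x -> (0 <= f1 x)%E) -> (forall x, D x -> (f1 x <= f2 x)%E) ->
  (\int[leb]_(x in D) f1 x <= \int[leb]_(x in D) f2 x)%E.
Proof.
move=> f10 f12; rewrite !ge0_integralE//; last by move=> x Dx; rewrite (le_trans _ (f12 _ Dx))// f10.
apply: le_ereal_sup => _ [h hf <-]; exists h => // x; apply: (le_trans (hf x)).
by rewrite !patchE; case: ifPn => // /set_mem; exact: f12.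
Qed.

(** The integrand may be singular at 0: the fundamental theorem of calculus is applied on
    [1/(n + 2), 1], followed by monotone convergence. The shift by 2 keeps these intervals
    nondegenerate. *)
Lemma integral_powR_itv01 (a : R) : -1 < a ->
  (\int[leb]_(x in `]0%R, 1%R]) (x `^ a)%:E <= (a + 1)^-1%:E)%E.
Proof.
move=> a1; have a10 : 0 < a + 1 by rewrite -ltrBlDr sub0r.
pose F (n : nat) : set R := `[n.+2%:R^-1, 1%R]%classic.
have F0 n x : F n x -> 0 < x.
  by rewrite /F/= in_itv/= => /andP[+ _]; apply: lt_le_trans; rewrite invr_gt0.
have UF : \bigcup_n F n = `]0%R, 1%R]%classic.
  apply/seteqP; split => x /=.
    by move=> [n _ Fx]; rewrite in_itv/= (F0 _ _ Fx)/=; move: Fx; rewrite /F/= in_itv/= => /andP[].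
  rewrite in_itv/= => /andP[x0 x1].
  exists (Num.Def.truncn x^-1) => //; rewrite /F/= in_itv/= x1 andbT.
  rewrite -[leRHS]invrK lef_pV2 ?posrE ?invr_gt0//.
  by apply: (le_trans (ltW (truncnS_gt _))); rewrite ler_nat.
have mpow D : measurable_fun D (fun x : R => (x `^ a)%:E).
  by apply/measurable_EFinP; apply: measurable_funTS.
rewrite -UF; apply: (cvge_to_le (ge0_nondecreasing_set_cvg_integral _ _ _ _)).
- move=> m n mn; apply/subsetPset => x; rewrite /F/= !in_itv/= => /andP[mx ->].
  by rewrite (le_trans _ mx)// lef_pV2 ?posrE// ler_nat.
- by move=> n; exact: measurable_itv.
- by move=> n; exact: mpow.
- by move=> n x _; rewrite lee_fin powR_ge0.
apply: nearW => n.
have dF (x : R) : 0 < x -> is_derive x 1 (fun y : R => (a + 1)^-1 * y `^ (a + 1)) (x `^ a).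
  move=> x0; have := is_derive1_powR (a + 1) x0.
  rewrite addrK => d; have := is_deriveZ (a + 1)^-1 (x := x) (df := (a + 1) * x `^ a).
  by rewrite /GRing.scale/= mulKf ?gt_eqF//; apply.
have dwithin (f : R -> R) : (forall x : R, 0 < x -> derivable f x 1) -> {within F n, continuous f}.
  by move=> df; apply: derivable_within_continuous => x /F0; exact: df.
rewrite (@continuous_FTC2 _ _ (fun x : R => (a + 1)^-1 * x `^ (a + 1))).
- rewrite powR1 mulr1 -EFinB lee_fin gerBl mulr_ge0 ?powR_ge0// invr_ge0 ltW//.
- by rewrite invf_lt1 ?ltr1n.
- by apply: dwithin => x x0; have [] := is_derive1_powR a x0.
- have n2 : n.+2%:R^-1 < 1 :> R by rewrite invf_lt1 ?ltr1n.
  have /(continuous_within_itvP _ n2)[? ? ?] : {within F n, continuous (fun x : R => (a + 1)^-1 * x `^ (a + 1))}.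
    by apply: dwithin => x x0; have [] := dF _ x0.
  split => // x; rewrite in_itv/= => /andP[nx _].
  by have [] := dF x (lt_trans _ nx).
- move=> x; rewrite in_itv/= => /andP[nx _].
  by rewrite derive1E; have [] := dF x (lt_trans _ nx).
Qed.

End L2Norm.

(** * Lower bound *)

Section ExpSums.
Context {R : realType}.
Implicit Types (t u : nat -> R) (m n : nat).

Local Notation leb := (@lebesgue_measure R).

(** An antiderivative of the squared sum at x is minus the Cauchy form with coefficients u_j e^{-t_j
    x}. *)
Lemma integral_exp_sum_sqr m t u (a b : R) : (forall j, 0 < t j) -> a < b ->
  (\int[leb]_(x in `[a, b]) ((\sum_(j < m) u j * expR (- (t j * x))) ^+ 2)%:E =
   (cauchy_form m t (fun j => u j * expR (- (t j * a))) -
    cauchy_form m t (fun j => u j * expR (- (t j * b))))%:E)%E.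
Proof.
move=> t0 ab.
pose F (x : R) := - cauchy_form m t (fun j => u j * expR (- (t j * x))).
pose G (x : R) := (\sum_(j < m) u j * expR (- (t j * x))) ^+ 2.
have dF (x : R) : is_derive x 1 F (G x).
  have -> : F = \sum_(j < m) \sum_(k < m) (fun x : R =>
      - (u j * u k / (t j + t k)) * expR (- (t j + t k) * x)).
    apply/funext => y; rewrite /F /cauchy_form fct_sumE -sumrN; apply: eq_bigr => j _.
    rewrite fct_sumE -sumrN; apply: eq_bigr => k _.
    have -> : - (t j + t k) * y = - (t j * y) + - (t k * y) by ring.
    by rewrite expRD; ring.
  have -> : G x = \sum_(j < m) \sum_(k < m) (u j * u k * expR (- (t j + t k) * x)).
    rewrite /G expr2 big_distrlr/=; apply: eq_bigr => j _; apply: eq_bigr => k _.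
    have -> : - (t j + t k) * x = - (t j * x) + - (t k * x) by ring.
    by rewrite expRD; ring.
  apply: is_derive_sum => j; apply: is_derive_sum => k.
  have tjk : t j + t k != 0 by rewrite gt_eqF// addr_gt0.
  apply: is_derive_eq.
  by rewrite /GRing.scale/=; field.
have derivable_continuous (f : R -> R) : (forall x, derivable f x 1) -> continuous f.
  by move=> df x; apply: differentiable_continuous; apply/derivable1_diffP.
have cG : continuous G.
  apply: derivable_continuous => x.
  have -> : G = (\sum_(j < m) (fun x : R => u j * expR (- (t j * x)))) ^+ 2.
    by apply/funext => y; rewrite /G exprfctE fct_sumE.
  by apply: derivableX; apply: derivable_sum => j; exact: ex_derive.
rewrite (@continuous_FTC2 _ G F)//.
- by rewrite -EFinB /F opprK addrC.
- exact: continuous_subspaceT.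
- have cF : continuous F by apply: derivable_continuous => x; have [] := dF x.
  split.
  + by move=> x _; have [] := dF x.
  + by apply: cvg_at_right_filter; exact: cF.
  + by apply: cvg_at_left_filter; exact: cF.
- by move=> x _; rewrite derive1E; have [] := dF x.
Qed.


(** In a geometric progression (t_i - t_j) / (t_i + t_j) depends on i - j only. The offset e^N makes
    the exponentials doubly exponentially small at x = 1. *)
Definition exp_node (N j : nat) : R := expR (N%:R + j%:R / N%:R).

Lemma exp_node_gt0 N j : 0 < exp_node N j.
Proof. exact: expR_gt0. Qed.

Lemma exp_node_ge N j : expR N%:R <= exp_node N j.
Proof. by rewrite ler_expR lerDl divr_ge0. Qed.

Lemma exp_node_ge1 N j : 1 <= exp_node N j.
Proof. by apply: le_trans (exp_node_ge N j); rewrite (le_trans _ (expR_ge1Dx _))// lerDl. Qed.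

Lemma exp_node_le N j : (0 < N)%N -> (j <= N * N)%N ->
  exp_node N j <= expR (2 * N%:R).
Proof.
move=> N0 jN; rewrite ler_expR [2 * _]mulr_natl mulr2n lerD2l ler_pdivrMr ?ltr0n//.
by rewrite -natrM ler_nat.
Qed.

(** The hypotheses say |ln u| <= s, which handles both signs of [c] at once. *)
Lemma powR_exp_le (s u c : R) : expR (- s) <= u -> u <= expR s ->
  expR (- (s * `|c|)) <= u `^ c <= expR (s * `|c|).
Proof.
move=> su us; have u0 : 0 < u := lt_le_trans (expR_gt0 _) su.
have lus : `|ln u| <= s.
  by rewrite ler_norml -ler_expR -[_ <= s]ler_expR !lnK ?posrE// su us.
rewrite -[u]lnK ?posrE// -expRM !ler_expR -ler_norml normrM.
by rewrite ler_wpM2r.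
Qed.

Lemma cauchy_form_exp_node N i (v : nat -> R) : (0 < N)%N ->
  v i ^+ 2 * expR (- (14 * N%:R)) / (2 * exp_node N i) <=
  cauchy_form i.+1 (exp_node N) v.
Proof.
move=> N0; apply: le_trans (cauchy_form_ge _ _ (exp_node_gt0 N)).
rewrite ler_wpM2r ?invr_ge0 ?mulr_ge0 ?(ltW (exp_node_gt0 _ _))//.
rewrite ler_wpM2l ?sqr_ge0// prodrXl.
have -> : - (14 * N%:R) = - (7 * N%:R) + - (7 * N%:R) :> R by ring.
rewrite expRD -expr2 lerXn2r ?nnegrE ?expR_ge0//.
  apply: prodr_ge0 => j _; rewrite divr_ge0 ?subr_ge0 ?addr_ge0 ?expR_ge0//.
  by rewrite ler_expR lerD2l ler_wpM2r ?invr_ge0// ler_nat ltnW.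
apply: le_trans (blaschke_prod_ge i N0) _.
(* Reversing the order of the predecessors turns the l-th factor into the one with gap l + 1. *)
rewrite (reindex_inj rev_ord_inj)/= le_eqVlt; apply/orP; left; apply/eqP.
apply: eq_bigr => j _.
have -> : exp_node N j = exp_node N i * expR (- ((i - j)%:R / N%:R)).
  rewrite -expRD natrB 1?ltnW//; congr expR; ring.
rewrite subnSK//.
have := exp_node_gt0 N i; set p := exp_node N i; set e := expR _ => p0.
have e0 : 0 < e by exact: expR_gt0.
field; apply/andP; split; rewrite gt_eqF//; first by rewrite addr_gt0// mulr_gt0.
by rewrite addr_gt0.
Qed.

(** On [e^{-2N}, 1] the squared weight is at least e^{-4|b|N}, and the remaining integral is the
    Cauchy form at e^{-2N} minus the one at 1; the first dominates because its last coefficient is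
    not too small. *)
Lemma exp_combination_ge (a b : R) N i (D : nat -> R) : (0 < N)%N ->
    (i < N * N)%N -> 8 * `|a| + 26 <= N%:R ->
    8 ^- N <= `|D i| -> \sum_(j < i.+1) `|D j| <= 1 ->
  ((expR (- ((4 * `|a| + 4 * `|b| + 26) * N%:R)))%:E <=
   \int[leb]_(x in `[0%R, 1%R]) ((x `^ b *
     \sum_(j < i.+1) D j * (exp_node N j `^ a * expR (- (exp_node N j * x)))) ^+ 2)%:E)%E.
Proof.
move=> N0 iN Nlarge Di Dsum.
pose t := exp_node N; pose w j := D j * t j `^ a; pose d := expR (- (2 * N%:R)) : R.
pose g x := \sum_(j < i.+1) w j * expR (- (t j * x)).
have NR : 1 <= N%:R :> R by rewrite ler1n.
have e2 : 2 <= expR 1 :> R by have := expR_ge1Dx (1 : R); lra.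
have d1 : d < 1 by rewrite expR_lt1 oppr_lt0 mulr_gt0// ltr0n.
have d0 : 0 < d by exact: expR_gt0.
have mg : measurable_fun [set: R] g.
  apply: measurable_sum => j; apply: measurable_funM => //; apply: measurableT_comp => //.
  by apply: measurableT_comp => //; exact: measurable_funM.
have tja j : (j <= N * N)%N -> expR (- (2 * N%:R * `|a|)) <= t j `^ a <= expR (2 * N%:R * `|a|).
  move=> jN; apply: powR_exp_le; last exact: exp_node_le.
  by apply: le_trans (exp_node_ge1 _ _); rewrite -expR0 ler_expR oppr_le0 mulr_ge0.
(* The last coefficient is at least e^{-3N} e^{-2N|a|} e^{-1}, since 8 <= e^3 and t_i d <= 1.
   Squaring, multiplying by e^{-14N} and dividing by 2 t_i <= e^{1 + 2N} costs (4|a| + 22) N + 3 in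
   the exponent, and 3 <= 3 N. *)
have lowQ : expR (- ((4 * `|a| + 25) * N%:R)) <=
    cauchy_form i.+1 t (fun j => w j * expR (- (t j * d))).
  apply: le_trans (cauchy_form_exp_node _ _ N0).
  have ti0 : 0 < t i := exp_node_gt0 N i.
  have /andP[tia _] := tja i (ltnW iN).
  have zge : expR (- (3 * N%:R + 2 * N%:R * `|a| + 1)) <= `|w i * expR (- (t i * d))|.
    rewrite !opprD !expRD !normrM (ger0_norm (powR_ge0 _ _)) (ger0_norm (expR_ge0 _)).
    rewrite ler_pM ?mulr_ge0 ?expR_ge0//.
      rewrite ler_pM ?expR_ge0// (le_trans _ Di)// expRN lef_pV2 ?posrE ?expR_gt0 ?exprn_gt0//.
      rewrite expRM_natr lerXn2r ?nnegrE ?expR_ge0//.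
      have -> : (3 : R) = 1 * 3%:R by rewrite mul1r.
      rewrite expRM_natr; have -> : (8 : R) = 2 ^+ 3 by ring.
      by rewrite lerXn2r ?nnegrE ?expR_ge0.
    rewrite ler_expR lerN2 /d expRN ler_pdivrMr ?expR_gt0// mul1r.
    exact: (exp_node_le N0 (ltnW iN)).
  rewrite ler_pdivlMr ?mulr_gt0// -[(w i * _) ^+ 2]ger0_norm ?sqr_ge0// normrX.
  apply: (@le_trans _ _ (expR (- ((4 * `|a| + 25) * N%:R)) * (expR 1 * expR (2 * N%:R)))).
    rewrite ler_wpM2l ?expR_ge0// ler_pM//; first exact: ltW.
    exact: (exp_node_le N0 (ltnW iN)).
  apply: (@le_trans _ _ (expR (- (3 * N%:R + 2 * N%:R * `|a| + 1)) ^+ 2 * expR (- (14 * N%:R)))); last first.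
    by rewrite ler_wpM2r ?expR_ge0// lerXn2r ?nnegrE ?expR_ge0.
  rewrite expr2 -!expRD ler_expR; nra.
(* The coefficients sum to at most e^{2N|a| - e^N}. As 2 e^N >= N^2, the assumption N >= 8|a| + 26
   is what makes its square small enough. *)
have upQ : cauchy_form i.+1 t (fun j => w j * expR (- (t j * 1))) <=
    expR (- ((4 * `|a| + 26) * N%:R)).
  apply: le_trans (cauchy_form_le _ _ (exp_node_ge1 N)) _.
  apply: (@le_trans _ _ (expR (2 * N%:R * `|a| - expR N%:R) ^+ 2)).
    rewrite lerXn2r ?nnegrE ?expR_ge0 ?sumr_ge0//.
    apply: (@le_trans _ _ (\sum_(j < i.+1) `|D j| * expR (2 * N%:R * `|a| - expR N%:R))).
      apply: ler_sum => j _; rewrite !normrM -mulrA ler_wpM2l// expRD.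
      have /andP[_ tjb] : expR (- (2 * N%:R * `|a|)) <= t j `^ a <= expR (2 * N%:R * `|a|).
        by apply: tja; rewrite (leq_trans _ iN)// ltnW.
      rewrite (ger0_norm (powR_ge0 _ _)) (ger0_norm (expR_ge0 _)) ler_pM ?powR_ge0 ?expR_ge0//.
      by rewrite ler_expR lerN2 mulr1 exp_node_ge.
    by rewrite -mulr_suml ler_piMl ?expR_ge0.
  rewrite expr2 -expRD ler_expR.
  have := expR_ge1Dxn 1 (ler0n R N); rewrite (_ : 2`!%:R = 2)//; nra.
apply: (@le_trans _ _ (\int[leb]_(x in `[d, 1%R]) ((x `^ b * g x) ^+ 2)%:E)%E); last first.
  rewrite [leRHS](_ : _ = \int[leb]_(x in `[0%R, 1%R]) ((x `^ b * g x) ^+ 2)%:E)%E; last first.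
    apply: eq_integral => x _; congr ((_ * _) ^+ 2)%:E; apply: eq_bigr => j _.
    by rewrite mulrA.
  apply: ge0_subset_integral => //.
  - by apply/measurable_EFinP; apply: measurable_funX; apply: measurable_funM; exact: measurable_funTS.
  - by move=> x _; rewrite lee_fin sqr_ge0.
  - by apply: subset_itv; rewrite bnd_simp // ltW.
apply: (@le_trans _ _ (\int[leb]_(x in `[d, 1%R]) ((expR (- (4 * `|b| * N%:R)))%:E * (g x ^+ 2)%:E))%E); last first.
  apply: ge0_le_integral => //.
  - by move=> x _; rewrite -EFinM lee_fin mulr_ge0 ?expR_ge0 ?sqr_ge0.
  - by apply/measurable_EFinP; apply: measurable_funM => //; apply: measurable_funX; exact: measurable_funTS.
  - by apply/measurable_EFinP; apply: measurable_funX; apply: measurable_funM; exact: measurable_funTS.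
  - move=> x /=; rewrite in_itv/= => /andP[dx x1]; rewrite -EFinM lee_fin exprMn ler_wpM2r ?sqr_ge0//.
    have /andP[xb _] : expR (- (2 * N%:R * `|b|)) <= x `^ b <= expR (2 * N%:R * `|b|).
      by apply: powR_exp_le => //; rewrite (le_trans x1)// -expR0 ler_expR mulr_ge0.
    have -> : - (4 * `|b| * N%:R) = - (2 * N%:R * `|b|) + - (2 * N%:R * `|b|) by ring.
    by rewrite expRD -expr2 lerXn2r ?nnegrE ?expR_ge0 ?powR_ge0.
rewrite ge0_integralZl_EFin ?expR_ge0//; last 2 first.
- by move=> x _; rewrite lee_fin sqr_ge0.
- by apply/measurable_EFinP; apply: measurable_funX; exact: measurable_funTS.
rewrite integral_exp_sum_sqr//; last by move=> j; exact: exp_node_gt0.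
rewrite -EFinM lee_fin.
have -> : - ((4 * `|a| + 4 * `|b| + 26) * N%:R) = - (4 * `|b| * N%:R) + - ((4 * `|a| + 26) * N%:R) by ring.
rewrite expRD ler_wpM2l ?expR_ge0// lerBrDr.
apply: le_trans lowQ; apply: le_trans (lerD (lexx _) upQ) _.
(* The spare unit in the exponent is a factor e^N >= 2, which pays for both the subtracted form and
   the claimed bound. *)
have -> : - ((4 * `|a| + 25) * N%:R) = N%:R + - ((4 * `|a| + 26) * N%:R) by ring.
rewrite expRD; set A := expR (- _).
have A0 : 0 < A by exact: expR_gt0.
by have := expR_ge1Dx (N%:R : R); nra.
Qed.

End ExpSums.

(** * Separated families and the size of covers *)

Section Packing.
Context {R : realType}.
Variables alpha beta : R.

Local Notation leb := (@lebesgue_measure R).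
Local Notation a' := (2 * beta + 1 - alpha).

Definition extend_ffun n m (k : {ffun 'I_n -> 'I_m}) (j : nat) : nat :=
  if insub j is Some i then k i else 0%N.

Lemma extend_ffunE n m (k : {ffun 'I_n -> 'I_m}) (j : 'I_n) : extend_ffun k j = k j.
Proof. by rewrite /extend_ffun valK. Qed.

(** Sending each grid combination to a ball that contains it is injective, because distinct
    combinations are too far apart to share one. *)
Lemma covers_packing_card N n e : (0 < N)%N -> 8 * `|a'| + 26 <= N%:R -> 0 < e ->
    4 * e ^+ 2 <= expR (- ((4 * `|a'| + 4 * `|beta| + 26) * N%:R)) ->
    L2_covers (laplace_class alpha beta) e n ->
  ((2 ^ N) ^ (N * N) <= n)%N.
Proof.
move=> N0 Nlarge e0 esmall [c [L2c cover]].
have e8 : 0 < (8 : R) ^+ N by rewrite exprn_gt0.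
pose v (k : {ffun 'I_(N * N) -> 'I_(2 ^ N)}) (j : nat) : R := (extend_ffun k j)%:R / 8 ^+ N.
have v0 k j : 0 <= v k j by rewrite divr_ge0// ltW.
pose f k (x : R) := x `^ beta *
  \sum_(j < N * N) v k j * (exp_node N j `^ a' * expR (- (exp_node N j * x))).
have v1 k (j : 'I_(N * N)) : v k j <= (2 ^ N)%:R / 8 ^+ N.
  rewrite ler_wpM2r ?invr_ge0 ?(ltW e8)// ler_nat extend_ffunE.
  exact/ltnW/ltn_ord.
(* The total mass is at most N^2 2^N / 8^N, and N <= 2^N. *)
have sum1 : \sum_(j < N * N) (2 ^ N)%:R / 8 ^+ N <= 1 :> R.
  rewrite sumr_const card_ord -[leLHS]mulr_natl mulrA ler_pdivrMr// mul1r -natrM.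
  have -> : (8 : R) ^+ N = (8 ^ N)%:R by rewrite natrX.
  rewrite ler_nat (_ : 8 ^ N = (2 ^ N * 2 ^ N) * 2 ^ N)%N; last by rewrite -!expnMn.
  by rewrite leq_mul2r leq_mul ?orbT// ltnW// ltn_expl.
have vsum k : \sum_(j < N * N) v k j <= 1.
  by apply: le_trans sum1; apply: ler_sum => j _; exact: v1.
have fF k : laplace_class alpha beta (f k).
  have := @laplace_class_atomic R alpha beta (N * N) (exp_node N) (fun j => NngNum (v0 k j)).
  by apply; [exact: exp_node_ge1|exact: vsum].
have mf k : measurable_fun (`[0 : R, 1 : R]%classic) (f k).
  apply: measurable_funTS; apply: measurable_funM => //.
  apply: measurable_sum => j; apply: measurable_funM => //; apply: measurable_funM => //.
  apply: measurableT_comp => //; apply: measurableT_comp => //; exact: measurable_funM.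
have [phi phiP] := choice (fun k => cover _ (fF k)).
have phi_inj : injective phi.
  move=> k k' kk'; apply: contrapT => /eqP neq.
  have [i0 di0] : exists i0, k i0 != k' i0.
    by apply/existsP; apply: contraNT neq; rewrite negb_exists => /forallP h;
      apply/eqP/ffunP => i; apply/eqP; have := h i; rewrite negbK.
  (* Take the last index where [k] and [k'] differ: the difference stops there, with a final
     coefficient of size at least 8^{-N}. *)
  have [i di imax] := @arg_maxnP _ i0 (fun i => k i != k' i) (fun i => i : nat) di0.
  pose D j := v k j - v k' j.
  have DE j : D j = ((extend_ffun k j)%:R - (extend_ffun k' j)%:R) / 8 ^+ N by rewrite /D mulrBl.
  have D0 (j : 'I_(N * N)) : (i < j)%N -> D j = 0.
    move=> ij; rewrite DE !extend_ffunE; suff /eqP -> : k j == k' j by rewrite subrr mul0r.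
    by apply: contraLR ij => dj; rewrite -leqNgt; exact: imax.
  have Di : 8 ^- N <= `|D i|.
    rewrite DE !extend_ffunE normrM [`|8 ^- N|]ger0_norm ?invr_ge0 ?(ltW e8)//.
    rewrite ler_peMl ?invr_ge0 ?(ltW e8)//.
    have := di; rewrite -val_eqE /= neq_ltn => /orP[lt|lt].
      by rewrite distrC ger0_norm ?subr_ge0 ?ler_nat ?(ltnW lt)// -natrB ?ler1n ?subn_gt0 ?(ltnW lt).
    by rewrite ger0_norm ?subr_ge0 ?ler_nat ?(ltnW lt)// -natrB ?ler1n ?subn_gt0 ?(ltnW lt).
  have Dsum : \sum_(j < i.+1) `|D j| <= 1.
    apply: (@le_trans _ _ (\sum_(j < N * N) `|D j|)).
      rewrite (big_ord_widen _ (fun j => `|D j|) (ltn_ord i)) [leRHS](bigID (fun j : 'I__ => (j < i.+1)%N))/=.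
      by rewrite lerDl sumr_ge0.
    apply: le_trans sum1; apply: ler_sum => j _; rewrite ler_norml.
    by have := v0 k j; have := v0 k' j; have := v1 k j; have := v1 k' j; rewrite /D; lra.
  have := exp_combination_ge beta N0 (ltn_ord i) Nlarge Di Dsum.
  apply/negP; rewrite -ltNge; apply: (@lt_le_trans _ _ (4 * e ^+ 2)%:E); last first.
    by rewrite lee_fin; exact: esmall.
  have := phiP k'; rewrite -kk' => pk'.
  apply: le_lt_trans (L2_separation e0 (mf k) (mf k') (L2c _) (phiP k) pk').
  rewrite le_eqVlt; apply/orP; left; apply/eqP; apply: eq_integral => x _.
  congr (_ ^+ 2)%:E; rewrite /f -mulrBr -sumrB; congr (_ * _).
  rewrite (big_ord_widen _ (fun j => D j * (exp_node N j `^ a' * expR (- (exp_node N j * x)))) (ltn_ord i)).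
  rewrite [RHS](bigID (fun j : 'I__ => (j < i.+1)%N))/= [X in _ = _ + X]big1 ?addr0.
    by apply: eq_bigr => j _; rewrite -mulrBl.
  by move=> j; rewrite -leqNgt => ij; rewrite -mulrBl -/(D j) D0// mul0r.
have := leq_card phi phi_inj.
by rewrite card_ffun !card_ord.
Qed.
End Packing.

(** * Upper bound *)

Section KernelApproximation.
Context {R : realType}.

Lemma exp_sum_le (z : R) m : 0 <= z -> \sum_(j < m) z ^+ j / j`!%:R <= expR z.
Proof.
move=> z0; have nd : nondecreasing_seq (series (exp_coeff z)).
  by apply: nondecreasing_series => n _ _; exact: exp_coeff_ge0.
have := nondecreasing_cvgn_le nd (is_cvg_series_exp_coeff z) m.
by rewrite /series/= big_mkord.
Qed.

(** For i >= m, z^i <= 2^{-m} (2 z)^i, so the tail is at most 2^{-m} times the series of e^{2z}.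
    Doubling the exponent buys geometric decay for every z. *)
Lemma exp_taylor_le (z : R) m : 0 <= z ->
  `|expR (- z) - \sum_(j < m) (- z) ^+ j / j`!%:R| <= 2 ^- m * expR (2 * z).
Proof.
move=> z0.
have cv : series (exp_coeff (- z)) n - \sum_(j < m) (- z) ^+ j / j`!%:R @[n --> \oo] -->
    expR (- z) - \sum_(j < m) (- z) ^+ j / j`!%:R.
  by apply: cvgB; [exact: is_cvg_series_exp_coeff|exact: cvg_cst].
apply: (cvgr_to_le (cvg_norm cv)); near=> n.
have mn : (m <= n)%N by near: n; exact: nbhs_infty_ge.
rewrite /series/= -[X in _ - X](big_mkord xpredT (fun j => (- z) ^+ j / j`!%:R)).
rewrite (big_cat_nat (n := m))//= addrAC subrr add0r.
apply: le_trans (ler_norm_sum _ _ _) _.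
apply: (@le_trans _ _ (\sum_(m <= i < n) 2 ^- m * ((2 * z) ^+ i / i`!%:R))).
  rewrite big_nat [leRHS]big_nat; apply: ler_sum => i /andP[mi _].
  rewrite normrM normrX normrN (ger0_norm z0) ger0_norm ?invr_ge0// mulrA ler_wpM2r ?invr_ge0//.
  rewrite exprMn mulrA ler_peMl ?exprn_ge0// -(subnK mi) exprD mulrCA mulVf ?mulr1 ?expf_neq0//.
  by rewrite exprn_ege1// ler1n.
rewrite -mulr_sumr ler_wpM2l ?invr_ge0 ?exprn_ge0//.
apply: le_trans (exp_sum_le n (mulr_ge0 (ler0n _ 2) z0)).
rewrite -(big_mkord xpredT (fun j => (2 * z) ^+ j / j`!%:R)) [leRHS](big_cat_nat (n := m))//=.
by rewrite lerDr sumr_ge0// => j _; rewrite divr_ge0// exprn_ge0// mulr_ge0.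
Unshelve. all: by end_near. Qed.

Lemma exp_powR_le (p : R) : 0 < p ->
  exists2 C, 0 < C & forall u, 0 < u -> expR (- (2 / 5 * u)) <= C * u `^ (- p).
Proof.
(* [c] is chosen so that p c u = 2 u / 5; then ln (c u) < c u is the claim. *)
move=> p0; pose c := 2 / (5 * p); have c0 : 0 < c by rewrite divr_gt0// mulr_gt0.
exists (expR (- (p * ln c))); first exact: expR_gt0.
move=> u u0; rewrite /powR gt_eqF// -expRD ler_expR.
have /ln_sublinear : 0 < c * u by rewrite mulr_gt0.
rewrite lnM ?posrE// => h.
have -> : 2 / 5 * u = p * (c * u) by rewrite /c; field; rewrite gt_eqF.
have : p * (ln c + ln u) <= p * (c * u) by rewrite ler_wpM2l// ltW.
nra.
Qed.

End KernelApproximation.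

(** * Separating t and x in the kernel *)

Section KernelDecomposition.
Context {R : realType}.
Variables a b p : R.
Hypothesis p0 : 0 < p.
Hypothesis ap : a < p.

Definition knot (k : nat) : R := (5 / 4) ^+ k.

Lemma knot_ge1 k : 1 <= knot k.
Proof. by rewrite exprn_ege1//; lra. Qed.

Lemma knot_gt0 k : 0 < knot k.
Proof. exact: lt_le_trans ltr01 (knot_ge1 k). Qed.

Lemma knotS k : knot k.+1 = 5 / 4 * knot k.
Proof. by rewrite /knot exprS. Qed.

Lemma ler_knot : {homo knot : m n / (m <= n)%N >-> m <= n}.
Proof. by move=> m n mn; rewrite ler_weXn2l//; lra. Qed.

Lemma knot_cover (t : R) N : 1 <= t -> t < knot N ->
  exists2 k, (k < N)%N & knot k <= t < knot k.+1.
Proof.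
move=> t1; elim: N => [|N IHN]; first by rewrite /knot expr0 ltNge t1.
move=> tN; have [tN'|Nt] := ltP t (knot N); last by exists N => //; rewrite Nt.
by have [k kN kt] := IHN tN'; exists k => //; exact: ltnW.
Qed.

Let A : R := (5 / 4) `^ `|a|.

Let A_gt0 : 0 < A. Proof. by rewrite powR_gt0//; lra. Qed.

(* On the k-th cell, with z = (t - t_k) x, the j-th term of the expansion
   t^a x^b e^{-t x} = t^a x^b e^{-t_k x} sum_j (-z)^j / j! factors as
   [moment k j t * atom k j x]; the constant A only serves to make the moments
   at most 1, and the factors 2 and 1/2 make the tail of the series decay as
   2^{-j} while keeping sum_j |atom k j x| under control. *)
Definition moment (k j : nat) (t : R) : R :=
  if (knot k <= t) && (t < knot k.+1)
  then (t / knot k) `^ a / A * (2 * (t - knot k) / knot k) ^+ j else 0.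

Definition atom (k j : nat) (x : R) : R :=
  A * knot k `^ a * x `^ b * expR (- (knot k * x)) * (- (knot k * x / 2)) ^+ j / j`!%:R.

Lemma moment_itv01 k j t : 0 <= moment k j t <= 1.
Proof.
rewrite /moment; case: ifPn => [/andP[kt tk]|_]; last by rewrite lexx ler01.
have k0 := knot_gt0 k.
have u1 : 1 <= t / knot k by rewrite ler_pdivlMr// mul1r.
have u2 : t / knot k <= 5 / 4 by rewrite ler_pdivrMr// -knotS ltW.
have -> : 2 * (t - knot k) / knot k = 2 * (t / knot k - 1) by field; rewrite gt_eqF.
set u := t / _ in u1 u2 *.
have uA : u `^ a <= A.
  apply: (@le_trans _ _ (u `^ `|a|)); first by rewrite ler_powR// ler_norm.
  by rewrite ge0_ler_powR// ?nnegrE; lra.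
have s0 : 0 <= 2 * (u - 1) by lra.
have s1 : 2 * (u - 1) <= 1 by lra.
rewrite mulr_ge0 ?divr_ge0 ?powR_ge0 ?exprn_ge0//= mulr_ile1 ?exprn_ile1 ?exprn_ge0 ?divr_ge0 ?powR_ge0//.
by rewrite ler_pdivrMr// mul1r.
Qed.

Lemma measurable_moment k j : measurable_fun [set: R] (moment k j).
Proof.
apply: measurable_fun_ifT => //.
  by apply: measurable_and; [exact: measurable_fun_ler|exact: measurable_fun_ltr].
apply: measurable_funM; last first.
  by apply: measurable_funX; do 2!apply: measurable_funM => //; exact: measurable_funB.
apply: measurable_funM => //.
apply: (measurableT_comp (measurable_powR a)); exact: measurable_funM.
Qed.

Lemma measurable_atom k j : measurable_fun [set: R] (atom k j).
Proof.
apply: measurable_funM => //; apply: measurable_funM; last first.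
  by apply: measurable_funX; apply: measurableT_comp => //; do !apply: measurable_funM => //.
apply: measurable_funM; first exact: measurable_funM.
by apply: measurableT_comp => //; apply: measurableT_comp => //; exact: measurable_funM.
Qed.

(** The exponential is traded for (t x)^{-p}: since a < p this makes large t negligible, uniformly
    against one fixed power of x. *)
Let kernel_decay : exists2 C, 0 < C & forall t x : R, 0 < t -> 0 < x ->
  t `^ a * x `^ b * expR (- (2 / 5 * (t * x))) <= C * t `^ (a - p) * x `^ (b - p).
Proof.
have [C C0 HC] := exp_powR_le p0; exists C => // t x t0 x0.
have := HC _ (mulr_gt0 t0 x0); rewrite powRM ?(ltW t0) ?(ltW x0)// => h.
have powB (y c : R) : 0 < y -> y `^ (c - p) = y `^ c * y `^ (- p).
  by move=> y0; rewrite powRD// (gt_eqF y0) implybT.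
rewrite !powB//; apply: (@le_trans _ _ (t `^ a * x `^ b * (C * (t `^ (- p) * x `^ (- p))))).
  by rewrite ler_wpM2l// mulr_ge0 ?powR_ge0.
by rewrite le_eqVlt; apply/orP; left; apply/eqP; ring.
Qed.

(** The factor 1/2 in the atoms makes their series at most e^{t_k x / 2}, so half of the decay
    e^{-t_k x} survives, more than the rate 2/5. *)
Lemma atom_row_le k m (x : R) : 0 < x ->
  \sum_(j < m) `|atom k j x| <= A * (knot k `^ a * x `^ b * expR (- (2 / 5 * (knot k * x)))).
Proof.
move=> x0; have k0 := knot_gt0 k; have kx := mulr_gt0 k0 x0.
apply: (@le_trans _ _ (A * (knot k `^ a * x `^ b) * expR (- (knot k * x)) *
    \sum_(j < m) (knot k * x / 2) ^+ j / j`!%:R)).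
  rewrite mulr_sumr; apply: ler_sum => j _.
  rewrite /atom !normrM normrX normrN (ger0_norm (expR_ge0 _)) !(ger0_norm (powR_ge0 _ _)).
  rewrite ?(gtr0_norm A_gt0) [`|knot k * x / 2|]ger0_norm ?divr_ge0 ?(ltW kx)//.
  by rewrite [`|_^-1|]ger0_norm ?invr_ge0// !mulrA.
have Sle := @exp_sum_le R (knot k * x / 2) m (divr_ge0 (ltW kx) (ler0n _ 2)).
rewrite -!mulrA ler_wpM2l ?(ltW A_gt0)// !mulrA -mulrA ler_wpM2l ?mulr_ge0 ?powR_ge0//.
apply: (@le_trans _ _ (expR (- (knot k * x)) * expR (knot k * x / 2))).
  by rewrite ler_wpM2l ?expR_ge0.
rewrite -expRD ler_expR; lra.
Qed.

Lemma moment_atom_row k m (t x : R) : 0 < x -> knot k <= t < knot k.+1 ->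
  `|t `^ a * x `^ b * expR (- (t * x)) - \sum_(j < m) moment k j t * atom k j x| <=
  2 ^- m * (t `^ a * x `^ b * expR (- (2 / 5 * (t * x)))).
Proof.
move=> x0 kt; have k0 := knot_gt0 k; have /andP[kt1 kt2] := kt.
have t0 : 0 < t := lt_le_trans k0 kt1.
pose z := (t - knot k) * x.
have z0 : 0 <= z by rewrite mulr_ge0 ?subr_ge0 ?(ltW x0).
have -> : \sum_(j < m) moment k j t * atom k j x =
    t `^ a * x `^ b * expR (- (knot k * x)) * \sum_(j < m) (- z) ^+ j / j`!%:R.
  rewrite mulr_sumr; apply: eq_bigr => j _; rewrite /moment kt /atom.
  have -> : t `^ a = (t / knot k) `^ a * knot k `^ a.
    by rewrite -powRM ?divr_ge0 ?(ltW t0) ?(ltW k0)// divfK ?gt_eqF.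
  have -> : - z = (2 * (t - knot k) / knot k) * (- (knot k * x / 2)).
    by rewrite /z; field; rewrite gt_eqF.
  rewrite [in RHS]exprMn; set X := (_ / knot k) ^+ j; set Y := (- _) ^+ j; have A0 : A != 0 by rewrite gt_eqF.
  have f0 : j`!%:R != 0 :> R by rewrite pnatr_eq0 -lt0n fact_gt0.
  by field; rewrite A0 f0.
have -> : - (t * x) = - (knot k * x) + - z by rewrite /z; ring.
rewrite expRD mulrA -mulrBr normrM.
rewrite ger0_norm; last by rewrite !mulr_ge0 ?powR_ge0 ?expR_ge0.
apply: le_trans (ler_wpM2l _ (exp_taylor_le m z0)) _.
  by rewrite !mulr_ge0 ?powR_ge0 ?expR_ge0.
rewrite mulrCA ler_wpM2l ?invr_ge0 ?exprn_ge0//.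
rewrite -!mulrA ler_wpM2l ?powR_ge0// ler_wpM2l ?powR_ge0//.
rewrite -expRD ler_expR /z.
have : t * x <= 5 / 4 * knot k * x by rewrite ler_wpM2r ?(ltW x0)// -knotS ltW.
(* From t <= 5 t_k / 4: -t_k x + 2 z = (2 t - 3 t_k) x <= -2 t x / 5. *)
nra.
Qed.

(** If t lies below the N-th knot, only the row of its own cell is nonzero and the Taylor bound
    gives 2^{-N}. Otherwise all moments vanish, and the kernel itself is of order t^{a - p}, at most
    (5/4)^{(a - p) N}. *)
Lemma kernel_decomposition : exists2 C, 0 < C & forall N (x : R), 0 < x ->
  \sum_(i : 'I_N * 'I_N) `|atom i.1 i.2 x| <= C * N%:R * x `^ (b - p) /\
  forall t, 1 <= t ->
    `|t `^ a * x `^ b * expR (- (t * x)) - \sum_(i : 'I_N * 'I_N) moment i.1 i.2 t * atom i.1 i.2 x|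
    <= C * (2 ^- N + (5 / 4) `^ ((a - p) * N%:R)) * x `^ (b - p).
Proof.
have [C C0 HC] := kernel_decay.
have tap t : 1 <= t -> t `^ (a - p) <= 1.
  by move=> t1; rewrite -[leRHS](powRr0 t) ler_powR// subr_le0 ltW.
have HC1 t x : 1 <= t -> 0 < x -> t `^ a * x `^ b * expR (- (2 / 5 * (t * x))) <= C * x `^ (b - p).
  move=> t1 x0; apply: le_trans (HC t x (lt_le_trans ltr01 t1) x0) _.
  by rewrite ler_wpM2r ?powR_ge0// ler_piMr ?(ltW C0)// tap.
exists (C * (A + 1)); first by rewrite mulr_gt0// addr_gt0.
move=> N x x0; split.
  rewrite -(pair_bigA _ (fun k j : 'I_N => `|atom k j x|))/=.
  apply: (@le_trans _ _ (\sum_(k < N) C * (A + 1) * x `^ (b - p))).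
    apply: ler_sum => k _; apply: le_trans (atom_row_le k N x0) _.
    apply: (@le_trans _ _ (A * (C * x `^ (b - p)))).
      by rewrite ler_wpM2l ?(ltW A_gt0)// HC1// knot_ge1.
    by rewrite mulrA ler_wpM2r ?powR_ge0// mulrDr mulr1 [A * C]mulrC lerDl ltW.
  by rewrite sumr_const card_ord -[leLHS]mulr_natr mulrAC.
move=> t t1; have t0 : 0 < t := lt_le_trans ltr01 t1.
rewrite -(pair_bigA _ (fun k j : 'I_N => moment k j t * atom k j x))/=.
have q0 : 0 <= (5 / 4 : R) `^ ((a - p) * N%:R) by exact: powR_ge0.
have h0 : 0 <= (2 : R) ^- N by rewrite invr_ge0 exprn_ge0.
have w0 := powR_ge0 x (b - p).
have CA : C <= C * (A + 1) by rewrite mulrDr mulr1 lerDr mulr_ge0 ?ltW.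
have [tN|Nt] := ltP t (knot N).
  have [k kN kt] := knot_cover t1 tN.
  rewrite (bigD1 (Ordinal kN))//= [X in _ - (_ + X)]big1 ?addr0; last first.
    move=> l /eqP lk; rewrite big1// => j _; rewrite /moment ifN ?mul0r//.
    apply/negP => /andP[lt1 lt2]; apply: lk; apply/val_inj => /=.
    have /andP[kt1 kt2] := kt.
    case: (ltngtP l k) => // h.
      by move: (lt_le_trans lt2 (ler_knot h)); rewrite ltNge kt1.
    by move: (lt_le_trans kt2 (ler_knot h)); rewrite ltNge lt1.
  apply: le_trans (moment_atom_row N x0 kt) _.
  apply: le_trans (ler_wpM2l h0 (HC1 _ _ t1 x0)) _.
  rewrite mulrA ler_wpM2r// mulrC.
  apply: ler_pM => //; [exact: ltW|by rewrite lerDl].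
rewrite big1 ?subr0; last first.
  move=> k _; rewrite big1// => j _; rewrite /moment ifN ?mul0r//.
  by rewrite negb_and -!leNgt (le_trans (ler_knot (ltn_ord k)) Nt) orbT.
rewrite ger0_norm ?mulr_ge0 ?powR_ge0 ?expR_ge0//.
apply: (@le_trans _ _ (t `^ a * x `^ b * expR (- (2 / 5 * (t * x))))).
  rewrite ler_wpM2l ?mulr_ge0 ?powR_ge0// ler_expR lerN2 ler_piMl ?mulr_ge0 ?(ltW t0) ?(ltW x0)//; lra.
apply: le_trans (HC _ _ t0 x0) _.
rewrite ler_wpM2r//; apply: ler_pM => //; [exact: ltW|exact: powR_ge0|].
apply: (@le_trans _ _ ((5 / 4) `^ ((a - p) * N%:R))); last by rewrite lerDr.
rewrite [_ * N%:R]mulrC powRrM powR_mulrn; last by rewrite divr_ge0.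
rewrite -/(knot N).
have -> : a - p = - (p - a) by ring.
rewrite !powRN lef_pV2 ?posrE ?powR_gt0 ?knot_gt0//.
rewrite ge0_ler_powR ?nnegrE ?(ltW t0) ?(ltW (knot_gt0 _))//.
  by rewrite subr_ge0 ltW.
Qed.

End KernelDecomposition.

(** * Integrating the approximation; rounding *)

Section Cover.
Context {R : realType}.

Local Notation leb := (@lebesgue_measure R).

(** A uniform error integrates to at most itself against mass at most 1. It is applied to each
    Jordan part with x fixed, [c] holding the values of the atoms at x divided by the weight. *)
Lemma Rintegral_separable_approx (I : finType) (nu : {finite_measure set (measurableTypeR R) -> \bar R})
    (J : set (measurableTypeR R)) (h : R -> R) (P : I -> R -> R) (c : I -> R) (B : R) :
    measurable J -> (nu setT <= 1)%E -> measurable_fun J h ->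
    (forall i, measurable_fun J (P i)) -> (forall i t, 0 <= P i t <= 1) -> 0 <= B ->
    (forall t, J t -> `|h t - \sum_i P i t * c i| <= B) ->
  `|\int[nu]_(t in J) h t - \sum_i (\int[nu]_(t in J) P i t) * c i| <= B.
Proof.
move=> mJ nu1 mh mP P01 B0 hB.
have nuJ : (nu J <= 1)%E by apply: le_trans nu1; apply: le_measure; rewrite ?inE.
have nuJfin : (nu J < +oo)%E by rewrite (le_lt_trans nuJ)// ltry.
have bint (g : R -> R) (M : R) : measurable_fun J g -> (forall t, J t -> `|g t| <= M) ->
    nu.-integrable J (EFin \o g).
  move=> mg gM; apply: measurable_bounded_integrable => //.
  by exists M; split; [exact: num_real|move=> y My t Jt /=; rewrite (le_trans (gM _ Jt))// ltW].
have Pi i : nu.-integrable J (EFin \o P i).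
  by apply: (bint _ 1) => // t _; have /andP[p0 p1] := P01 i t; rewrite ger0_norm.
have Pci i : nu.-integrable J (EFin \o (fun t => P i t * c i)).
  apply: (bint _ `|c i|); first exact: measurable_funM.
  move=> t _; have /andP[p0 p1] := P01 i t.
  by rewrite normrM ger0_norm// ler_piMl.
have mS : measurable_fun J (fun t => \sum_i P i t * c i).
  by apply: measurable_sum => i; exact: measurable_funM.
have Si : nu.-integrable J (EFin \o (fun t => \sum_i P i t * c i)).
  apply: (bint _ (\sum_i `|c i|)) => // t _; apply: le_trans (ler_norm_sum _ _ _) _.
  apply: ler_sum => i _; have /andP[p0 p1] := P01 i t.
  by rewrite normrM ger0_norm// ler_piMl.
(* [h] is bounded on [J], being within [B] of a bounded function. *)
have hi : nu.-integrable J (EFin \o h).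
  apply: (bint _ (B + \sum_i `|c i|)) => // t Jt.
  rewrite -[h t](subrK (\sum_i P i t * c i)) (le_trans (ler_normD _ _))// lerD ?hB//.
  apply: le_trans (ler_norm_sum _ _ _) _.
  apply: ler_sum => i _; have /andP[p0 p1] := P01 i t.
  by rewrite normrM ger0_norm// ler_piMl.
have -> : \sum_i (\int[nu]_(t in J) P i t) * c i = \int[nu]_(t in J) (\sum_i P i t * c i).
  transitivity (\sum_i \int[nu]_(t in J) (P i t * c i)).
    by apply: eq_bigr => i _; rewrite RintegralZr.
  rewrite /Rintegral; under [in RHS]eq_integral do rewrite -sumEFin.
  rewrite integral_sum// -sum_fine// => i _.
  exact: (integrable_fin_num mJ (Pci i)).
rewrite -RintegralB//.
have di : nu.-integrable J (EFin \o (fun t => h t - \sum_i P i t * c i)).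
  by apply: (bint _ B) => //; exact: measurable_funB.
apply: le_trans (le_normr_Rintegral _ di) _ => //.
apply: (@le_trans _ _ (\int[nu]_(t in J) B)).
  apply: le_Rintegral => //.
  - apply: (bint _ B); first by apply: measurableT_comp => //; exact: measurable_funB.
    by move=> t Jt; rewrite normr_id hB.
  - by apply: (bint _ B) => // t _; rewrite ger0_norm.
rewrite Rintegral_cst// ler_piMr//.
by rewrite -[leRHS]/(fine 1%E) fine_le// ge0_fin_numE.
Qed.

Lemma Rintegral_itv01 (nu : {finite_measure set (measurableTypeR R) -> \bar R})
    (J : set (measurableTypeR R)) (P : R -> R) :
    measurable J -> (nu setT <= 1)%E -> measurable_fun J P ->
    (forall t, 0 <= P t <= 1) ->
  0 <= \int[nu]_(t in J) P t <= 1.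
Proof.
move=> mJ nu1 mP P01.
have nuJ : (nu J <= 1)%E by apply: le_trans nu1; apply: le_measure; rewrite ?inE.
have nuJfin : (nu J < +oo)%E by rewrite (le_lt_trans nuJ)// ltry.
have bint (g : R -> R) : measurable_fun J g -> (forall t, 0 <= g t <= 1) ->
    nu.-integrable J (EFin \o g).
  move=> mg g01; apply: measurable_bounded_integrable => //.
  exists 1; split; first exact: num_real.
  move=> y y1 t _ /=; have /andP[g0 g1] := g01 t.
  by rewrite ger0_norm// (le_trans g1)// ltW.
apply/andP; split; first by apply: Rintegral_ge0 => t _; have /andP[] := P01 t.
apply: (@le_trans _ _ (\int[nu]_(t in J) 1)).
  apply: le_Rintegral => //; [exact: bint| |by move=> t _; have /andP[] := P01 t].
  by apply: bint => // t; rewrite ler01 lexx.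
rewrite Rintegral_cst// mul1r.
by rewrite -[leRHS]/(fine 1%E) fine_le// ge0_fin_numE.
Qed.

Lemma integral_sqr_dominated (h w : R -> R) (B V : R) : 0 <= B ->
    measurable_fun [set: R] w ->
    (\int[leb]_(x in `]0%R, 1%R]) (w x ^+ 2)%:E <= V%:E)%E ->
    (forall x, 0 < x <= 1 -> `|h x| <= B * w x) ->
  (\int[leb]_(x in `[0%R, 1%R]) (h x ^+ 2)%:E <= (B ^+ 2 * V)%:E)%E.
Proof.
move=> B0 mw wV hB.
(* h is unconstrained at 0, hence the value +oo there. *)
pose phi (x : R) : \bar R := if x == 0 then +oo%E else ((B ^+ 2) * w x ^+ 2)%:E.
have mBw : measurable_fun [set: R] (fun x => (B ^+ 2 * w x ^+ 2)%:E).
  by apply/measurable_EFinP; apply: measurable_funM => //; exact: measurable_funX.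
have mphi : measurable_fun (`]0%R, 1%R]%classic : set R) phi.
  apply: (eq_measurable_fun (fun x => (B ^+ 2 * w x ^+ 2)%:E)); last exact: measurable_funTS.
  by move=> x; rewrite inE/= in_itv/= => /andP[x0 _]; rewrite /phi gt_eqF.
apply: (@le_trans _ _ (\int[leb]_(x in `[0%R, 1%R]) phi x)%E).
  apply: ge0_le_integral_nonmeasurable; first by move=> x _; rewrite lee_fin sqr_ge0.
  move=> x /=; rewrite in_itv/= /phi => /andP[x0 x1]; case: ifPn => [_|x0']; first exact: leey.
  have {}x0 : 0 < x by rewrite lt_neqAle eq_sym x0'.
  rewrite lee_fin -exprMn -[h x ^+ 2]ger0_norm ?sqr_ge0// normrX.
  have hx : `|h x| <= B * w x by rewrite hB ?x0.
  by rewrite lerXn2r ?nnegrE// (le_trans _ hx).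
rewrite -integral_itv_obnd_cbnd//.
have -> : (\int[leb]_(x in `]0%R, 1%R]) phi x =
    \int[leb]_(x in `]0%R, 1%R]) ((B ^+ 2)%:E * (w x ^+ 2)%:E))%E.
  apply: eq_integral => x.
  by rewrite inE/= in_itv/= => /andP[x0 _]; rewrite /phi gt_eqF.
rewrite ge0_integralZl_EFin ?sqr_ge0//; last 2 first.
- by move=> x _; rewrite lee_fin sqr_ge0.
- by apply/measurable_EFinP; apply: measurable_funTS; exact: measurable_funX.
by rewrite [leRHS]EFinM; apply: lee_wpmul2l => //; rewrite lee_fin sqr_ge0.
Qed.

Lemma grid_approx (M : nat) (a : R) : (0 < M)%N -> 0 <= a <= 1 ->
  exists k : 'I_M.+1, `|a - k%:R / M%:R| <= M%:R^-1.
Proof.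
move=> M0 /andP[a0 a1]; have MR : 0 < M%:R :> R by rewrite ltr0n.
have Ma : 0 <= M%:R * a by rewrite mulr_ge0// ltW.
have /andP[k1 k2] := truncn_itv Ma.
(* The endpoint a = 1 rounds to k = M, hence M + 1 grid values. *)
have kM : (Num.Def.truncn (M%:R * a) < M.+1)%N.
  by rewrite ltnS -(ler_nat R) (le_trans k1)// ler_piMr// ltW.
exists (Ordinal kM) => /=; set k := Num.Def.truncn _ in k1 k2 *.
have -> : a - k%:R / M%:R = (M%:R * a - k%:R) / M%:R by field; rewrite gt_eqF.
rewrite normrM [`|_^-1|]ger0_norm ?invr_ge0 ?(ltW MR)// ler_piMl ?invr_ge0 ?(ltW MR)//.
by rewrite ger0_norm ?subr_ge0// lerBlDr addrC natr1 ltW.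
Qed.

End Cover.

(** * Finite covers of the class *)

Section UpperCover.
Context {R : realType}.

Local Notation leb := (@lebesgue_measure R).

Lemma L2_01_dominated (h w : R -> R) (B V : R) : 0 <= B ->
    measurable_fun [set: R] h -> measurable_fun [set: R] w ->
    (\int[leb]_(x in `]0%R, 1%R]) (w x ^+ 2)%:E <= V%:E)%E ->
    (forall x, 0 < x <= 1 -> `|h x| <= B * w x) ->
  L2_01 h.
Proof.
move=> B0 mh mw wV hB.
apply/andP; split; rewrite inE/=.
  by rewrite patch_indic; exact: measurable_funM.
rewrite /finite_norm -[X in (X < _)%E]/(L2norm01 h) L2norm01E.
have := integral_sqr_dominated B0 mw wV hB.
by case: (\int[_]_(_ in _) _)%E => [r|//|//] _; rewrite ltry.
Qed.

(** [u] and [v], coming from the positive and negative parts, are rounded separately to multiples of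
    1/M: each difference moves by at most 2/M, and there are two grid values to choose per index. *)
Lemma covers_of_approx (F : set (R -> R)) (I : finType) (g : I -> R -> R)
    (w : R -> R) (B S V e : R) (M : nat) :
    0 <= B -> 0 <= S -> (0 < M)%N -> 0 < e ->
    measurable_fun [set: R] w -> (forall i, measurable_fun [set: R] (g i)) ->
    (\int[leb]_(x in `]0%R, 1%R]) (w x ^+ 2)%:E <= V%:E)%E ->
    (forall x, 0 < x <= 1 -> \sum_i `|g i x| <= S * w x) ->
    (forall f, F f -> exists u v : I -> R,
      [/\ forall i, 0 <= u i <= 1, forall i, 0 <= v i <= 1 &
          forall x, 0 < x <= 1 -> `|f x - \sum_i (u i - v i) * g i x| <= B * w x]) ->
    (B + 2 * S / M%:R) ^+ 2 * V < e ^+ 2 ->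
  L2_covers F e (M.+1 ^ (2 * #|I|)).
Proof.
move=> B0 S0 M0 e0 mw mg wV gS Fapprox small.
have MR : 0 < M%:R :> R by rewrite ltr0n.
pose K := ({ffun I -> 'I_M.+1} * {ffun I -> 'I_M.+1})%type.
pose c (k : K) (x : R) := \sum_i ((k.1 i)%:R / M%:R - (k.2 i)%:R / M%:R) * g i x.
have -> : (M.+1 ^ (2 * #|I|) = #|{: K}|)%N.
  by rewrite card_prod !card_ffun !card_ord -expnD mul2n addnn.
exists (fun j => c (enum_val j)); split => [j|f Ff].
  set k := enum_val j.
  apply: (L2_01_dominated (B := S) S0 _ mw wV).
    by apply: measurable_sum => i; exact: measurable_funM.
  move=> x x01; apply: le_trans (ler_norm_sum _ _ _) _; apply: le_trans (gS x x01).
  apply: ler_sum => i _; rewrite normrM ler_piMl// ler_norml.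
  have grid01 (m : 'I_M.+1) : 0 <= (m%:R / M%:R : R) <= 1.
    by apply/andP; split; [exact: divr_ge0|rewrite ler_pdivrMr// mul1r ler_nat -ltnS].
  by have /andP[] := grid01 (k.1 i); have /andP[] := grid01 (k.2 i); lra.
have [u [v [u01 v01 fuv]]] := Fapprox f Ff.
have [ku kuP] := choice (fun i => grid_approx M0 (u01 i)).
have [kv kvP] := choice (fun i => grid_approx M0 (v01 i)).
pose k : K := ([ffun i => ku i], [ffun i => kv i]).
exists (enum_rank k); rewrite enum_rankK L2norm01_lt//.
apply: (@le_lt_trans _ _ ((B + 2 * S / M%:R) ^+ 2 * V)%:E); last by rewrite lte_fin.
apply: integral_sqr_dominated mw wV _ => [|x x01].
  by rewrite addr_ge0// divr_ge0 ?mulr_ge0// ltW.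
rewrite -[f x](subrK (\sum_i (u i - v i) * g i x)) -addrA (le_trans (ler_normD _ _))//.
rewrite mulrDl lerD ?fuv// /c -sumrB; apply: le_trans (ler_norm_sum _ _ _) _.
apply: (@le_trans _ _ (\sum_i 2 / M%:R * `|g i x|)).
  apply: ler_sum => i _; rewrite -mulrBl normrM ler_wpM2r// !ffunE/=.
  have := kuP i; have := kvP i; rewrite !ler_norml => /andP[? ?] /andP[? ?].
  by apply/andP; split; lra.
have -> : 2 * S / M%:R * w x = 2 / M%:R * (S * w x) by field; rewrite gt_eqF.
rewrite -mulr_sumr ler_wpM2l ?gS//.
Qed.

Lemma laplace_class_covers (alpha beta p : R) :
    0 < p -> 2 * beta + 1 - alpha < p -> p < beta + 1 / 2 ->
  exists2 C, 0 < C & forall N e, (0 < N)%N -> 0 < e ->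
    C * N%:R * (2 ^- N + (5 / 4) `^ ((2 * beta + 1 - alpha - p) * N%:R)) < e ->
    L2_covers (laplace_class alpha beta) e ((2 ^ N).+1 ^ (2 * (N * N))).
Proof.
set a := 2 * beta + 1 - alpha => p0 ap pb.
have [C C0 HC] := kernel_decomposition beta p0 ap.
(* The bound for the integral of x^{2 (beta - p)} over ]0, 1], positive since p < beta + 1/2. *)
pose V := (2 * (beta - p) + 1)^-1.
have V0 : 0 < V by rewrite invr_gt0; lra.
pose w (x : R) := x `^ (beta - p).
have mw : measurable_fun [set: R] w by exact: measurable_powR.
have wV : (\int[leb]_(x in `]0%R, 1%R]) (w x ^+ 2)%:E <= V%:E)%E.
  apply: le_trans (integral_powR_itv01 _); last by lra.
  rewrite le_eqVlt; apply/orP; left; apply/eqP; apply: eq_integral => x _.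
  by rewrite /w -powR_mulrn ?powR_ge0// -powRrM mulrC.
exists (4 * C * (V + 1)); first by rewrite !mulr_gt0// addr_gt0.
move=> N e N0 e0; set rho := (5 / 4) `^ _ => small.
have rho0 : 0 <= rho by exact: powR_ge0.
have h0 : 0 <= (2 : R) ^- N by rewrite invr_ge0 exprn_ge0.
have NR : 1 <= N%:R :> R by rewrite ler1n.
have -> : (N * N)%N = #|{: 'I_N * 'I_N}| by rewrite card_prod card_ord.
(* The factor 2 accounts for the two Jordan parts. *)
pose B := 2 * (C * (2 ^- N + rho)).
apply: (@covers_of_approx _ ('I_N * 'I_N)%type (fun i => atom a beta i.1 i.2) w B (C * N%:R) V e (2 ^ N)) => //.
- by rewrite mulr_ge0// mulr_ge0 ?addr_ge0// ltW.
- by rewrite mulr_ge0// ltW.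
- by rewrite expn_gt0.
- by move=> i; exact: measurable_atom.
- by move=> x /andP[x0 _]; have [] := HC N x x0.
- move=> f [mu [null tv ff]].
  pose nup : {finite_measure set (measurableTypeR R) -> \bar R} := jordan_pos (hahn_posneg mu).
  pose nun : {finite_measure set (measurableTypeR R) -> \bar R} := jordan_neg (hahn_posneg mu).
  have nup1 : (nup setT <= 1)%E.
    by apply: le_trans tv; rewrite /charge_tv_norm /charge_variation/= leeDl.
  have nun1 : (nun setT <= 1)%E.
    by apply: le_trans tv; rewrite /charge_tv_norm /charge_variation/= leeDr.
  pose J : set (measurableTypeR R) := `[1%R, +oo[%classic.
  have mJ : measurable J by exact: measurable_itv.
  have P01 (i : 'I_N * 'I_N) t : 0 <= moment a i.1 i.2 t <= 1 by exact: moment_itv01.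
  have mP (i : 'I_N * 'I_N) : measurable_fun J (moment a i.1 i.2).
    by apply: measurable_funTS; exact: measurable_moment.
  exists (fun i : 'I_N * 'I_N => \int[nup]_(t in J) moment a i.1 i.2 t).
  exists (fun i : 'I_N * 'I_N => \int[nun]_(t in J) moment a i.1 i.2 t).
  split; [by move=> i; exact: Rintegral_itv01|by move=> i; exact: Rintegral_itv01|].
  move=> x /andP[x0 x1]; have [_ kerx] := HC N x x0.
  have xb0 : 0 < x `^ beta by exact: powR_gt0.
  pose h t := t `^ a * expR (- (t * x)).
  (* The atoms contain the weight x^beta, which the class keeps outside the integral. *)
  pose c (i : 'I_N * 'I_N) := atom a beta i.1 i.2 x / x `^ beta.
  pose B1 := C * (2 ^- N + rho) * w x.
  have B10 : 0 <= B1 by rewrite !mulr_ge0 ?powR_ge0 ?addr_ge0// ltW.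
  have mh : measurable_fun J h.
    apply: measurable_funM; first exact: measurable_funTS.
    apply: measurable_funTS; apply: measurableT_comp => //.
    by apply: measurableT_comp => //; exact: measurable_funM.
  have hB t : J t -> `|h t - \sum_(i : 'I_N * 'I_N) moment a i.1 i.2 t * c i| <= B1 / x `^ beta.
    rewrite /J/= in_itv/= andbT => t1; rewrite ler_pdivlMr// -[X in _ * X]gtr0_norm// -normrM.
    rewrite mulrBl mulr_suml; apply: le_trans (kerx t t1).
    rewrite le_eqVlt; apply/orP; left; apply/eqP; congr `|_ - _|.
      by rewrite /h mulrAC.
    by apply: eq_bigr => i _; rewrite /c mulrA divfK ?gt_eqF.
  have B1b : 0 <= B1 / x `^ beta by rewrite divr_ge0// ltW.
  have up := Rintegral_separable_approx mJ nup1 mh mP P01 B1b hB.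
  have un := Rintegral_separable_approx mJ nun1 mh mP P01 B1b hB.
  rewrite ff ?in_itv/= ?x0// /charge_integral.
  set Ip := Rintegral _ _ _ in up *; set In := Rintegral _ _ _ in un *.
  set Sp := \sum_i _ in up; set Sn := \sum_i _ in un.
  have -> : \sum_(i : 'I_N * 'I_N) (\int[nup]_(t in J) moment a i.1 i.2 t - \int[nun]_(t in J) moment a i.1 i.2 t) *
     atom a beta i.1 i.2 x = x `^ beta * (Sp - Sn).
    rewrite -sumrB mulr_sumr; apply: eq_bigr => i _; rewrite /c.
    by field; rewrite gt_eqF.
  rewrite -mulrBr normrM (gtr0_norm xb0).
  have -> : B * w x = x `^ beta * (2 * (B1 / x `^ beta)).
    by rewrite [RHS]mulrCA (mulrC _ (B1 / _)) divfK ?gt_eqF// /B /B1 !mulrA.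
  rewrite ler_wpM2l ?(ltW xb0)//.
  move: up un; rewrite !ler_norml => /andP[? ?] /andP[? ?].
  by apply/andP; split; lra.
(* Approximation and rounding errors together are at most [Y]; V <= (V + 1)^2 then avoids a square
   root of [V]. *)
rewrite natrX; set X := B + _; pose Y := 4 * C * N%:R * (2 ^- N + rho).
have X0 : 0 <= X by rewrite /X /B addr_ge0 ?mulr_ge0 ?addr_ge0 ?invr_ge0 ?exprn_ge0// ltW.
have XY : X <= Y.
  have CN : C <= C * N%:R by rewrite ler_peMr// ltW.
  have := ler_wpM2r h0 CN; have := ler_wpM2r rho0 CN; rewrite /X /Y /B.
  have : 0 <= C * N%:R * 2 ^- N by rewrite !mulr_ge0// ltW.
  have : 0 <= C * rho by rewrite mulr_ge0// ltW.
  nra.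
apply: (@le_lt_trans _ _ ((Y * (V + 1)) ^+ 2)); last first.
  rewrite ltrXn2r ?nnegrE ?(ltW e0)//; last first.
    by apply: le_lt_trans small; rewrite le_eqVlt; apply/orP; left; apply/eqP; rewrite /Y; ring.
  by rewrite mulr_ge0 ?addr_ge0 ?(ltW V0)// (le_trans X0).
rewrite exprMn; apply: ler_pM; [exact: sqr_ge0|exact: ltW| |nra].
by rewrite lerXn2r ?nnegrE// (le_trans X0).
Qed.
End UpperCover.

(** * Asymptotics *)

Section Asymptotics.
Context {R : realType}.
Variables alpha beta : R.

Local Notation F := (laplace_class alpha beta).

Lemma covering_number_le (e : R) n : L2_covers F e n -> (covering_number F e <= n%:R%:E)%E.
Proof. by move=> cov; apply: ereal_inf_lbound; exists n. Qed.

Lemma lne_covering_number_upper :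
    0 < beta + 1 / 2 -> beta + 1 / 2 < alpha ->
  exists K d : R, [/\ 0 < K, 0 < d &
  forall e, 0 < e -> e < d -> (lne (covering_number F e) <= (K * (- ln e) ^+ 3)%:E)%E].
Proof.
move=> hbeta halpha; have : 2 * beta + 1 - alpha < beta + 1 / 2 by lra.
set a := 2 * beta + 1 - alpha => ab.
have [p [p0 ap pb]] : exists p, [/\ 0 < p, a < p & p < beta + 1 / 2].
  exists ((Num.max 0 a + (beta + 1 / 2)) / 2).
  have am : a <= Num.max 0 a by rewrite le_max lexx orbT.
  have m0 : 0 <= Num.max 0 a by rewrite le_max lexx.
  have mb : Num.max 0 a < beta + 1 / 2.
    by rewrite gt_max hbeta.
  by split; lra.
have [C C0 HC] := laplace_class_covers p0 ap pb.
(* A common exponential rate for the two errors 2^{-N} and (5/4)^{(a - p) N}. *)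
pose kappa := Num.min (ln 2) ((p - a) * ln (5 / 4)) : R.
have ln20 : 0 < ln 2 :> R by rewrite ln_gt0//; lra.
have ln540 : 0 < ln (5 / 4) :> R by rewrite ln_gt0//; lra.
have k0 : 0 < kappa by rewrite lt_min ln20 mulr_gt0// subr_gt0.
have k1 : kappa <= ln 2 by rewrite ge_min lexx.
have k2 : kappa <= (p - a) * ln (5 / 4) by rewrite ge_min lexx orbT.
pose C2 := 4 * C / kappa.
have C20 : 0 < C2 by rewrite divr_gt0// mulr_gt0.
exists (4 * (4 / kappa + 1) ^+ 3), (expR (- (1 + `|ln C2|))); split.
- by rewrite mulr_gt0// exprn_gt0// addr_gt0// divr_gt0.
- exact: expR_gt0.
move=> e e0 ed; pose L := - ln e.
have Lbig : 1 + `|ln C2| < L by rewrite /L ltrNr -ltr_expR lnK.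
have L1 : 1 < L by apply: le_lt_trans Lbig; rewrite lerDl.
have LC : ln C2 < L by apply: le_lt_trans Lbig; rewrite (le_trans (ler_norm _))// lerDr.
(* Half of the decay e^{-kappa N} absorbs the factor N; the other half is below e^{-2L}, and the
   constant [C2] is below e^L, leaving e^{-L} = e. *)
have [N [N0 N3 kN]] : exists N, [/\ (0 < N)%N, N%:R <= (4 / kappa + 1) * L & 4 * L < kappa * N%:R].
  have kL0 : 0 <= 4 / kappa * L by rewrite mulr_ge0 ?divr_ge0 ?(ltW k0)// (le_trans ler01) ?ltW.
  have /andP[N1 N2] := truncn_itv kL0.
  exists (Num.Def.truncn (4 / kappa * L)).+1; split => //.
    by rewrite -[leLHS]natr1 [leRHS]mulrDl mul1r lerD// ltW.
  by rewrite [ltRHS]mulrC -ltr_pdivrMr// [ltLHS]mulrAC.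
have cov : L2_covers F e ((2 ^ N).+1 ^ (2 * (N * N))).
  apply: HC => //.
  have exp1 : 2 ^- N <= expR (- (kappa * N%:R)).
    rewrite expRN lef_pV2 ?posrE ?expR_gt0 ?exprn_gt0//.
    rewrite expRM_natr lerXn2r ?nnegrE ?expR_ge0//.
    by rewrite -[leRHS](@lnK R) ?posrE// ler_expR.
  have exp2 : (5 / 4) `^ ((a - p) * N%:R) <= expR (- (kappa * N%:R)).
    have q0 : 0 < 5 / 4 :> R by rewrite divr_gt0.
    rewrite /powR (gt_eqF q0) ler_expR.
    have -> : (a - p) * N%:R * ln (5 / 4) = - ((p - a) * ln (5 / 4) * N%:R) by ring.
    by rewrite lerN2 ler_wpM2r.
  apply: (@le_lt_trans _ _ (C2 * expR (- (kappa * N%:R / 2)))).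
    have h : kappa * N%:R / 2 <= expR (kappa * N%:R / 2).
      by apply: le_trans (expR_ge1Dx _); rewrite lerDr.
    have kN2 : expR (- (kappa * N%:R)) = expR (- (kappa * N%:R / 2)) ^+ 2.
      by rewrite expr2 -expRD; congr expR; field.
    apply: (@le_trans _ _ (C * N%:R * (expR (- (kappa * N%:R)) + expR (- (kappa * N%:R))))).
      by rewrite ler_wpM2l ?lerD// mulr_ge0// ltW.
    have -> : C * N%:R * (expR (- (kappa * N%:R)) + expR (- (kappa * N%:R))) =
        C2 * expR (- (kappa * N%:R / 2)) * (kappa * N%:R / 2 * expR (- (kappa * N%:R / 2))).
      by rewrite kN2 /C2; field; rewrite gt_eqF.
    apply: ler_piMr; first by apply: mulr_ge0; [exact: ltW|exact: expR_ge0].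
    by rewrite expRN ler_pdivrMr ?expR_gt0// mul1r.
  rewrite -[X in _ < X]lnK ?posrE// -[C2]lnK ?posrE// -expRD ltr_expR -/L.
  by rewrite -[ln e]opprK -/L; clear - LC kN L1; lra.
have pos n : (0 < n)%N -> (n%:R%:E : \bar R) \in `[0%E, +oo%E].
  by move=> n0; rewrite in_itv/= lee_fin ler0n leey.
have covN : (covering_number F e <= (2 ^ (4 * N ^ 3))%:R%:E)%E.
  apply: le_trans (covering_number_le cov) _; rewrite lee_fin ler_nat.
  (* As 2^N + 1 <= 2^{2N}, the cover has at most 2^{4 N^3} balls. *)
  apply: (@leq_trans ((2 ^ (2 * N)) ^ (2 * (N * N)))).
    rewrite leq_exp2r ?muln_gt0 ?N0//.
    have N2 : (2 <= 2 ^ N)%N by rewrite -[X in (X <= _)%N]expn1 leq_exp2l.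
    by rewrite mul2n -addnn expnD; move: N2; clear; nia.
  by rewrite -expnM leq_exp2l// mulnACA !expnS expn0 muln1.
have cov0 : (0 <= covering_number F e)%E.
  by apply: le_ereal_inf_tmp => _ [n _ <-]; rewrite lee_fin.
apply: (@le_trans _ _ (lne (2 ^ (4 * N ^ 3))%:R%:E)).
  by rewrite lee_lne ?pos ?expn_gt0// in_itv/= cov0 leey.
rewrite lne_EFin ?ltr0n ?expn_gt0// lee_fin natrX lnXn// -[leLHS]mulr_natl.
rewrite natrM natrX -[leLHS]mulrA -[leRHS]mulrA ler_wpM2l//.
have ln21 : ln 2 <= 1 :> R by apply: le_trans (le_ln1Dx _) _; lra.
rewrite -/L -[leRHS]exprMn; apply: (@le_trans _ _ (N%:R ^+ 3)); first by rewrite ler_piMr.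
by rewrite lerXn2r ?nnegrE// (le_trans _ N3).
Qed.


Lemma lne_covering_number_lower : exists K d : R, [/\ 0 < K, 0 < d &
  forall e, 0 < e -> e < d -> ((K * (- ln e) ^+ 3)%:E <= lne (covering_number F e))%E].
Proof.
set a := 2 * beta + 1 - alpha.
pose C := 4 * `|a| + 4 * `|beta| + 26.
have a0 := normr_ge0 a; have b0 := normr_ge0 beta.
have C0 : 0 < C by rewrite /C; lra.
(* For L above this, the integer part N of L / C is at least L / (2C), hence large enough for the
   packing, and ln 4 <= 2 <= L with C N <= L gives 4 e^2 <= e^{-C N}. *)
pose Lmin := 2 + 2 * C * (8 * `|a| + 27).
exists (ln 2 * (1 / (2 * C)) ^+ 3), (expR (- Lmin)); split.
- by rewrite mulr_gt0 ?exprn_gt0 ?divr_gt0 ?mulr_gt0// ln_gt0// ltr1n.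
- exact: expR_gt0.
move=> e e0 ed; pose L := - ln e.
have Lbig : Lmin < L by rewrite /L ltrNr -ltr_expR lnK.
have L2 : 2 <= L.
  by apply: le_trans (ltW Lbig); rewrite /Lmin lerDl mulr_ge0 ?mulr_ge0 ?addr_ge0 ?mulr_ge0// ltW.
have LC : 8 * `|a| + 27 <= L / (2 * C).
  rewrite ler_pdivlMr ?mulr_gt0// mulrC (le_trans _ (ltW Lbig))//.
  by rewrite /Lmin lerDr.
have [N N1 NL] : exists2 N, N%:R <= L / C & L / (2 * C) <= N%:R.
  have LC2 : L / C = 2 * (L / (2 * C)) by field; rewrite gt_eqF.
  have LC0 : 0 <= L / C by rewrite divr_ge0 ?(le_trans _ L2) ?(ltW C0).
  have /andP[N1 N2] := truncn_itv LC0.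
  exists (Num.Def.truncn (L / C)) => //; rewrite -natr1 in N2; move: N2.
  by move: (Num.Def.truncn _)%:R => r; move: LC LC2 a0; clear; lra.
have N0 : (0 < N)%N by rewrite -(ltr0n R) (lt_le_trans _ NL)// (lt_le_trans _ LC)// ltr_wpDl ?mulr_ge0.
have lowN n : L2_covers F e n -> ((2 ^ N) ^ (N * N) <= n)%N.
  apply: covers_packing_card => //; first by rewrite -/a; lra.
  rewrite -/a -/C -[e]lnK ?posrE// -expRM_natl -(@lnK R 4) ?posrE// -expRD ler_expR.
  have CN : C * N%:R <= L by rewrite mulrC -ler_pdivlMr.
  have l4 : ln 4 <= 2 :> R.
    have -> : (4 : R) = 2 ^+ 2 by ring.
    have ln21 : ln 2 <= 1 :> R by apply: le_trans (le_ln1Dx _) _; lra.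
    by rewrite lnXn// mulr2n; lra.
  by rewrite -[ln e]opprK -/L; lra.
have cov : ((2 ^ (N * (N * N)))%:R%:E <= covering_number F e)%E.
  apply: le_ereal_inf_tmp => _ [n /= /lowN nN <-]; rewrite lee_fin ler_nat.
  by rewrite expnM.
apply: (@le_trans _ _ (lne (2 ^ (N * (N * N)))%:R%:E)); last first.
  rewrite lee_lne// in_itv/= leey andbT ?lee_fin//.
  by apply: le_trans cov; rewrite lee_fin.
rewrite lne_EFin ?ltr0n ?expn_gt0// lee_fin natrX lnXn// -[leRHS]mulr_natr -[leLHS]mulrA.
rewrite ler_wpM2l ?ln_ge0 ?ler1n// -/L -exprMn div1r mulrC !natrM.
have -> : N%:R * (N%:R * N%:R) = N%:R ^+ 3 :> R by ring.
by rewrite lerXn2r ?nnegrE// (le_trans _ LC)// addr_ge0 ?mulr_ge0.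
Qed.


End Asymptotics.

(** The limit superior is an infimum over neighbourhoods, and ]0, d[ is one of them. *)
Lemma limf_esup_at_right_lty (R : realType) (f : R -> \bar R) (K d : R) :
  0 < d -> (forall e, 0 < e -> e < d -> (f e <= K%:E)%E) ->
  (limf_esup f 0^'+ < +oo)%E.
Proof.
move=> d0 fK; apply: (@le_lt_trans _ _ K%:E); last exact: ltry.
apply: (@le_trans _ _ (ereal_sup [set f x | x in [set e : R | 0 < e < d]])).
  apply: ereal_inf_lbound; exists [set e | 0 < e < d] => //.
  by near=> e; apply/andP; split; near: e; [exact: nbhs_right_gt|exact: nbhs_right_lt].
by apply: ge_ereal_sup => _ [e /andP[e0 ed] <-]; exact: fK.
Unshelve. all: by end_near. Qed.

Theorem corollary1 (R : realType) (alpha beta : R)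
    (hbeta : 0 < beta + 1 / 2) (halpha : beta + 1 / 2 < alpha) :
  asymp_at0 (fun e : R => lne (covering_number (laplace_class alpha beta) e))
            (fun e : R => (`|ln e| ^+ 3)%:E).
Proof.
split.
- have [K [d [K0 d0 H]]] := lne_covering_number_upper hbeta halpha.
  (* Staying below e^{-1} keeps -ln e positive, so that it equals |ln e|. *)
  apply: (@limf_esup_at_right_lty _ _ K (Num.min d (expR (- 1)))).
    by rewrite lt_min d0 expR_gt0.
  move=> e e0; rewrite lt_min => /andP[ed e1].
  have L0 : 0 < - ln e by rewrite oppr_gt0 ln_lt0// e0 (lt_trans e1)// expR_lt1; lra.
  rewrite -normrN gtr0_norm// inver gt_eqF ?exprn_gt0//.
  by rewrite lee_pdivrMr ?exprn_gt0//; exact: H.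
- have [K [d [K0 d0 H]]] := lne_covering_number_lower alpha beta.
  apply: (@limf_esup_at_right_lty _ _ K^-1 (Num.min d (expR (- 1)))).
    by rewrite lt_min d0 expR_gt0.
  move=> e e0; rewrite lt_min => /andP[ed e1].
  have L0 : 0 < - ln e by rewrite oppr_gt0 ln_lt0// e0 (lt_trans e1)// expR_lt1; lra.
  rewrite -normrN gtr0_norm//; have := H e e0 ed.
  (* If the logarithm is +oo the quotient is 0; the value -oo contradicts the lower bound. *)
  case: (lne _) => [r| |]; rewrite ?lee_fin.
  + move=> Kr; have r0 : 0 < r by apply: lt_le_trans Kr; rewrite mulr_gt0// exprn_gt0.
    rewrite inver gt_eqF// -EFinM lee_fin ler_pdivrMr// mulrC ler_pdivlMr//.
    by rewrite mulrC.
  + by move=> _; rewrite mulr0 invr_ge0 ltW.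
  + by rewrite leeNy_eq.
Qed.
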